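(* Let $\mathbf{Z}=\mathbf{Z}_{\bar 0}\oplus\mathbf{Z}_{\bar 1}$ be a complex naturally graded filiform Zinbiel superalgebra with $\dim(\mathbf{Z}_{\bar 0})=n\ge 5$ and $\dim(\mathbf{Z}_{\bar 1})=m>3$. For $\alpha\in\mathbb{C}$ consider, on the $\mathbb{Z}_2$-graded space with even basis $e_1,\dots,e_n$ and odd basis $f_1,\dots,f_m$, the products $$(\ast)_\alpha:\quad \begin{cases} e_ie_j=\binom{i+j-1}{j}e_{i+j}, & i,j\ge 1,\ 2\le i+j\le n-1,\\[2mm] e_if_j=\dfrac{\prod_{k=0}^{i-2}(\alpha+j+k)}{(i-1)!}\,f_{j+i}, & 1\le i\le n-1,\ 1\le j\le m,\\[2mm] f_je_i=\dfrac{\prod_{k=0}^{i-1}(\alpha+j+k-1)}{i!}\,f_{j+i}, & 1\le i\le n-1,\ 1\le j\le m,\end{cases}$$ where $f_p:=0$ for $p>m$ and the empty product ($i=1$ in the second line) equals $1$. Then $\mathbf{Z}$ is isomorphic to one of the following superalgebras (all products of basis vectors not listed are zero): - $\mathfrak{nf}_1$: the products $(\ast)_{\alpha}$ with $\alpha=-1$, together with $e_nf_1=f_2$ and $f_1e_n=-f_2$; - $\mathfrak{nf}_2^{\alpha}$, for some $\alpha\in\mathbb{C}$: the products $(\ast)_\alpha$ only; - $\mathfrak{nf}_3$: the products $(\ast)_\alpha$ with $\alpha=2-m$, together with $e_nf_{m-1}=f_m$; or, in the case $m\ge n-2$, to one of the previous superalgebras or one of the following two: - $\mathfrak{nf}_4$: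 the products $(\ast)_\alpha$ with $\alpha=3-n$, together with $f_1f_{n-2}=e_{n-1}$; - $\mathfrak{nf}_5$: the products $(\ast)_\alpha$ with $\alpha=3-n$, together with $e_nf_{n-2}=f_{n-1}$ and $f_1f_{n-2}=e_{n-1}$.
   Context: A Zinbiel superalgebra is a $\mathbb{Z}_2$-graded vector space $\mathbf{Z}=\mathbf{Z}_{\bar 0}\oplus\mathbf{Z}_{\bar 1}$ with a bilinear product satisfying $\mathbf{Z}_i\mathbf{Z}_j\subset\mathbf{Z}_{i+j}$ and $(xy)z=x\big(yz+(-1)^{|y||z|}zy\big)$ for all homogeneous $x,y,z$. Isomorphisms preserve the $\mathbb{Z}_2$-grading. Sequences: $\mathbf{Z}_{\bar 0}^1=\mathbf{Z}_{\bar 0}$, $\mathbf{Z}_{\bar 0}^{k+1}=\mathbf{Z}_{\bar 0}\mathbf{Z}_{\bar 0}^k$; $\mathbf{Z}_{\bar 1}^1=\mathbf{Z}_{\bar 1}$, $\mathbf{Z}_{\bar 1}^{k+1}=\mathbf{Z}_{\bar 0}\mathbf{Z}_{\bar 1}^k$. Filiform: for $x\in\mathbf{Z}_{\bar 0}$ let $L_x(y)=xy$, and let $C_0(x)$ and $C_1(x)$ be the descending sequences of sizes of the Jordan blocks of $L_x$ acting on $\mathbf{Z}_{\bar 0}$ and on $\mathbf{Z}_{\bar 1}$ respectively. The characteristic sequence of $\mathbf{Z}$ is $C(\mathbf{Z})=\big(\max_{x\in\mathbf{Z}_{\bar 0}\setminus\mathbf{Z}_{\bar 0}^2}C_0(x)\,\big|\,\max_{y\in\mathbf{Z}_{\bar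 0}\setminus\mathbf{Z}_{\bar 0}^2}C_1(y)\big)$, maxima being lexicographic. It is assumed throughout that both maxima are attained at one and the same element $x\in\mathbf{Z}_{\bar 0}\setminus\mathbf{Z}_{\bar 0}^2$ (the characteristic element). With $\dim\mathbf{Z}_{\bar 0}=n$ and $\dim\mathbf{Z}_{\bar 1}=m$, $\mathbf{Z}$ is filiform if $C(\mathbf{Z})=(n-1,1\,|\,m)$, i.e. the maximal sequence on $\mathbf{Z}_{\bar 0}$ is $(n-1,1)$ and on $\mathbf{Z}_{\bar 1}$ it is $(m)$. Naturally graded: put $\mathfrak{z}^i_{\bar 0}=\mathbf{Z}_{\bar 0}^{i}/\mathbf{Z}_{\bar 0}^{i+1}$, $\mathfrak{z}^i_{\bar 1}=\mathbf{Z}_{\bar 1}^{i}/\mathbf{Z}_{\bar 1}^{i+1}$ and $\mathfrak{z}^i=\mathfrak{z}^i_{\bar 0}\oplus\mathfrak{z}^i_{\bar 1}$ for $i\ge 1$. $\mathbf{Z}$ is naturally graded if (1) $\mathrm{gr}(\mathbf{Z})=\bigoplus_i\mathfrak{z}^i$, with the product induced from $\mathbf{Z}$, is a graded superalgebra, i.e. $\mathfrak{z}^i\mathfrak{z}^j\subset\mathfrak{z}^{i+j}$ (so $\mathbf{Z}_a^i\mathbf{Z}_b^j\subset\mathbf{Z}_{a+b}^{i+j}$ for all $a,b\in\mathbb{Z}_2$, $i,j\ge 1$); and (2) $\mathbf{Z}$ and $\mathrm{gr}(\mathbf{Z})$ are isomorphic. *)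

(* Defs.v *)
From HB Require Import structures.
From mathcomp Require Import all_boot all_order all_algebra.

Set Implicit Arguments.
Unset Strict Implicit.
Unset Printing Implicit Defensive.

Import Order.TTheory GRing.Theory Num.Theory.
Local Open Scope ring_scope.

(* The parity is a bool: [homog Z false] is the even part, [homog Z true] the
   odd part, and parities are added with (+). No identity is imposed on the
   product here; see [zinbiel]. *)
Record superalgebra (K : fieldType) := Superalgebra {
  carrier :> vectType K;
  homog : bool -> {vspace carrier};
  smul : {bilinear carrier -> carrier -> carrier};
  homog_full : (homog false + homog true = fullv)%VS;
  homog_cap : (homog false :&: homog true = 0)%VS;
  smul_homog : forall a b x y,
    x \in homog a -> y \in homog b -> smul x y \in homog (a (+) b)
}.

Section Superalgebras.
Variable K : fieldType.
Implicit Types (Z A B : superalgebra K) (a b c : bool).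

Definition zinbiel Z : Prop :=
  forall a b c (x y z : Z),
    x \in homog Z a -> y \in homog Z b -> z \in homog Z c ->
  smul Z (smul Z x y) z =
  smul Z x (smul Z y z + (-1) ^+ (b && c) *: smul Z z y).

Definition superalgebra_iso A B : Prop :=
  exists phi : 'Hom(A, B),
    [/\ lker phi = 0%VS, limg phi = fullv,
        forall a, (phi @: homog A a)%VS = homog B a
      & forall x y, phi (smul A x y) = smul B (phi x) (phi y)].

(* The product UW of two subspaces is the span of the products uw. *)
Definition sprod Z (U W : {vspace Z}) : {vspace Z} :=
  <<[seq smul Z u w | u <- vbasis U, w <- vbasis W]>>%VS.

Lemma sprodP Z (U W T : {vspace Z}) :
  reflect (forall u w, u \in U -> w \in W -> smul Z u w \in T)
          (sprod U W <= T)%VS.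
Proof.
apply: (iffP span_subvP) => [sT u w uU wW | sT v /allpairsP[[u w] /= [uU wW ->]]].
  rewrite (coord_vbasis uU) (coord_vbasis wW) linear_sumlz /=.
  apply: memv_suml => i _; rewrite linear_sumr /=; apply: memv_suml => j _.
  rewrite linearZl_LR linearZr_LR /= !memvZ //; apply: sT; apply/allpairsP.
  exists ((vbasis U)`_i, (vbasis W)`_j); split=> //=;
  by apply: mem_nth; rewrite size_tuple.
by apply: sT; apply: vbasis_mem.
Qed.

(* [zpow Z a k] is Z_a^k; only the values for k >= 1 are meaningful. *)
Definition zpow Z a (k : nat) : {vspace Z} :=
  iter k.-1 (sprod (homog Z false)) (homog Z a).

Lemma zpowS Z a k :
  (0 < k)%N -> zpow Z a k.+1 = sprod (homog Z false) (zpow Z a k).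
Proof. by case: k. Qed.

Lemma zpow_subS Z a k : (zpow Z a k.+2 <= zpow Z a k.+1)%VS.
Proof.
elim: k => [|k IHk].
  by apply/sprodP => u w u0 wa; rewrite -[a]/(false (+) a); apply: smul_homog.
rewrite zpowS // [X in (_ <= X)%VS]zpowS //; apply/sprodP => u w u0 wk.
by move/sprodP: (subvv (sprod (homog Z false) (zpow Z a k.+1))); apply=> //;
   apply: subvP wk.
Qed.

Lemma zpow_stationary Z a k :
  (\dim {:Z} < k)%N -> zpow Z a k.+1 = zpow Z a k.
Proof.
move=> ltNk.
have stab j : zpow Z a j.+2 = zpow Z a j.+1 ->
    forall l, zpow Z a (l + j).+2 = zpow Z a (l + j).+1.
  by move=> e; elim=> // l IHl; rewrite addSn zpowS // IHl -zpowS.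
have bound j : zpow Z a j.+2 <> zpow Z a j.+1 ->
    (\dim (zpow Z a j.+2) + j < \dim {:Z})%N.
  elim: j => [|j IHj] ne.
    rewrite addn0; apply: leq_trans (dimvS (subvf (zpow Z a 1))).
    by rewrite ltnNge; apply/negP => le; apply: ne; apply/eqP; rewrite eqEdim zpow_subS.
  have ne' : zpow Z a j.+2 <> zpow Z a j.+1.
    by move=> e; apply: ne; apply: (stab j e 1%N).
  apply: leq_trans (IHj ne'); rewrite addnS ltnS ltn_add2r.
  by rewrite ltnNge; apply/negP => le; apply: ne; apply/eqP; rewrite eqEdim zpow_subS.
case: k ltNk => // k; rewrite ltnS => leNk.
case: (zpow Z a k.+2 =P zpow Z a k.+1) => // /bound lt.
by move: (leq_trans (leq_ltn_trans (leq_addl _ _) lt) leNk); rewrite ltnn.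
Qed.

Definition jordan_block (lam : K) (k : nat) : 'M[K]_k :=
  \matrix_(i, j) (if i == j then lam else if (i.+1 == j)%N then 1 else 0).

Definition jordan_mx (s : seq nat) (lam : 'I_(size s) -> K) :
    'M[K]_(\sum_(l < size s) nth 0%N s l) :=
  \mxdiag_(l < size s) jordan_block (lam l) (nth 0%N s l).

(* s is the descending sequence of the sizes of the Jordan blocks of the
   restriction of f to U: in some basis of U, f acts by a block diagonal matrix
   of Jordan blocks with these sizes. *)
Definition jordan_sizes (V : vectType K) (f : V -> V) (U : {vspace V})
    (s : seq nat) : Prop :=
  [/\ sorted geq s, 0%N \notin s
    & exists (lam : 'I_(size s) -> K)
             (X : (\sum_(l < size s) nth 0%N s l).-tuple V),
        basis_of U X /\
        forall j, f (tnth X j) = \sum_i jordan_mx lam i j *: tnth X i].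

(* Z has characteristic sequence (s | t); this includes that both
   lexicographic maxima are attained at a common element x. *)
Definition characteristic_sequence Z (s t : seq nat) : Prop :=
  exists x : Z,
    [/\ x \in homog Z false, x \notin zpow Z false 2,
        jordan_sizes (smul Z x) (homog Z false) s,
        jordan_sizes (smul Z x) (homog Z true) t
      & forall (y : Z) (r : seq nat),
          y \in homog Z false -> y \notin zpow Z false 2 ->
          (jordan_sizes (smul Z y) (homog Z false) r ->
             ((r : seqlexi nat) <= s)%O) /\
          (jordan_sizes (smul Z y) (homog Z true) r ->
             ((r : seqlexi nat) <= t)%O)].

Definition filiform Z : Prop :=
  characteristic_sequence Z
    [:: (\dim (homog Z false)).-1; 1%N] [:: \dim (homog Z true)].

End Superalgebras.

(* A superalgebra on V0 * V1 given by the four homogeneous components of its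
   product. *)
Section PairSuperalgebra.
Variables (K : fieldType) (V0 V1 : vectType K).
Variables (m00 : {bilinear V0 -> V0 -> V0}) (m01 : {bilinear V0 -> V1 -> V1}).
Variables (m10 : {bilinear V1 -> V0 -> V1}) (m11 : {bilinear V1 -> V1 -> V0}).

Definition pair_mul (x y : V0 * V1) : V0 * V1 :=
  (m00 x.1 y.1 + m11 x.2 y.2, m01 x.1 y.2 + m10 x.2 y.1).

Lemma pair_mul_bilinear : bilinear_for *:%R *:%R pair_mul.
Proof.
split=> z a x y; apply: injective_projections;
by rewrite /= ?linearPl ?linearPr scalerDr -!addrA; congr (_ + _); rewrite addrCA.
Qed.

HB.instance Definition _ :=
  bilinear_isBilinear.Build K (V0 * V1)%type (V0 * V1)%type (V0 * V1)%type
    *:%R *:%R pair_mul pair_mul_bilinear.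

Definition pair_homog (a : bool) : {vspace (V0 * V1)%type} :=
  if a then lker (linfun (fst : V0 * V1 -> V0))
  else lker (linfun (snd : V0 * V1 -> V1)).

Lemma mem_pair_homog a x :
  (x \in pair_homog a) = if a then x.1 == 0 else x.2 == 0.
Proof. by rewrite /pair_homog; case: a; rewrite memv_ker lfunE. Qed.

Lemma pair_homog_full : (pair_homog false + pair_homog true = fullv)%VS.
Proof.
apply/eqP; rewrite eqEsubv subvf; apply/subvP => -[u v] _.
have -> : (u, v) = (u, 0) + (0, v) :> V0 * V1.
  by congr (_, _); rewrite /= ?addr0 ?add0r.
by rewrite memv_add // mem_pair_homog /=.
Qed.

Lemma pair_homog_cap : (pair_homog false :&: pair_homog true = 0)%VS.
Proof.
apply/eqP; rewrite -subv0; apply/subvP => -[u v].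
by rewrite memv_cap !mem_pair_homog memv0 /= => /andP[/eqP-> /eqP->].
Qed.

Lemma pair_mul_homog a b x y :
  x \in pair_homog a -> y \in pair_homog b -> pair_mul x y \in pair_homog (a (+) b).
Proof.
rewrite !mem_pair_homog /pair_mul; case: a; case: b => /= /eqP-> /eqP->;
by rewrite ?linear0l ?linear0r ?addr0.
Qed.

Definition pair_superalgebra : superalgebra K :=
  Superalgebra pair_homog_full pair_homog_cap pair_mul_homog.

End PairSuperalgebra.

(* The quotient Z_a^i / Z_a^(i+1) is realised by the complement
   Z_a^i :\: Z_a^(i+1), with quotient map [addv_pi1 (Z_a^i) (Z_a^(i+1))] (the
   projection along Z_a^(i+1)). The filtration is stationary from
   k = \dim {:Z} + 1 on ([zpow_stationary]), so that the degrees
   i = 1, ..., \dim {:Z} exhaust gr(Z); an index i : 'I_(\dim {:Z}) stands for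
   the degree i.+1. *)
Section AssociatedGraded.
Variables (K : fieldType) (Z : superalgebra K).
Local Notation N := (\dim {: Z}).
Implicit Types a b : bool.

Definition gr_comp a (k : nat) : {vspace Z} := (zpow Z a k :\: zpow Z a k.+1)%VS.
Definition gr_pi a (k : nat) : 'End(Z) := addv_pi1 (zpow Z a k) (zpow Z a k.+1).

Definition gr_coord (i : 'I_N) (g : {ffun 'I_N -> Z}) : Z := g i.

Lemma gr_coord_linear i : linear (gr_coord i).
Proof. by move=> c g h; rewrite /gr_coord !ffunE. Qed.
HB.instance Definition _ i :=
  GRing.isLinear.Build K {ffun 'I_N -> Z} Z *:%R (gr_coord i) (gr_coord_linear i).

Definition gr_space a : {vspace {ffun 'I_N -> Z}} :=
  (\bigcap_(i < N) (linfun (gr_coord i) @^-1: gr_comp a i.+1))%VS.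

Lemma mem_gr_space a (g : {ffun 'I_N -> Z}) :
  reflect (forall i, g i \in gr_comp a i.+1) (g \in gr_space a).
Proof.
apply: (iffP idP) => [gP i | gP].
  have: g \in (linfun (gr_coord i) @^-1: gr_comp a i.+1)%VS.
    by apply: subvP gP; rewrite /gr_space (bigD1 i) //= capvSl.
  by rewrite -memv_preim lfunE.
rewrite /gr_space; elim/big_ind: _ => [|U W gU gW|i _].
- exact: memvf.
- by rewrite memv_cap gU.
- by rewrite -memv_preim lfunE; apply: gP.
Qed.

Definition gr_mulf a b (g h : {ffun 'I_N -> Z}) : {ffun 'I_N -> Z} :=
  [ffun k : 'I_N => gr_pi (a (+) b) k.+1
     (\sum_(i < N) \sum_(j < N | (i.+1 + j.+1 == k.+1)%N) smul Z (g i) (h j))].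

Lemma gr_mulf_mem a b g h : gr_mulf a b g h \in gr_space (a (+) b).
Proof. by apply/mem_gr_space => i; rewrite ffunE; apply: memv_pi. Qed.

Definition gr_mul a b (g : subvs_of (gr_space a)) (h : subvs_of (gr_space b)) :
    subvs_of (gr_space (a (+) b)) :=
  Subvs (gr_mulf_mem a b (vsval g) (vsval h)).

Lemma gr_mul_bilinear a b : bilinear_for *:%R *:%R (@gr_mul a b).
Proof.
split=> g c x y; apply/val_inj/ffunP => k; rewrite /= !ffunE /=.
  rewrite -[RHS]linearP; apply: (congr1 (gr_pi _ _)); rewrite scaler_sumr -big_split /=.
  apply: eq_bigr => i _; rewrite scaler_sumr -big_split /=.
  by apply: eq_bigr => j _; rewrite !ffunE linearPl.
rewrite -[RHS]linearP; apply: (congr1 (gr_pi _ _)); rewrite scaler_sumr -big_split /=.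
apply: eq_bigr => i _; rewrite scaler_sumr -big_split /=.
by apply: eq_bigr => j _; rewrite !ffunE linearPr.
Qed.

HB.instance Definition _ a b :=
  bilinear_isBilinear.Build K (subvs_of (gr_space a)) (subvs_of (gr_space b))
    (subvs_of (gr_space (a (+) b))) *:%R *:%R (@gr_mul a b)
    (gr_mul_bilinear a b).

Definition gr : superalgebra K :=
  pair_superalgebra (@gr_mul false false) (@gr_mul false true)
                    (@gr_mul true false) (@gr_mul true true).

Lemma zpowS_sub a k : (0 < k)%N -> (zpow Z a k.+1 <= zpow Z a k)%VS.
Proof. by case: k => // k _; apply: zpow_subS. Qed.

Lemma gr_pi_sub a k x :
  (0 < k)%N -> x \in zpow Z a k -> x - gr_pi a k x \in zpow Z a k.+1.
Proof.
move=> k_gt0 xk; set U := zpow Z a k; set W := zpow Z a k.+1.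
have xUW : x \in (U + W)%VS by rewrite (addv_idPl (zpowS_sub a k_gt0)).
by rewrite -[X in X - _](addv_pi1_pi2 xUW) addrC addKr; apply: memv_pi2.
Qed.

Lemma gr_pi_eq0 a k x :
  (0 < k)%N -> x \in zpow Z a k -> (gr_pi a k x == 0) = (x \in zpow Z a k.+1).
Proof.
move=> k_gt0 xk; have xpi := gr_pi_sub k_gt0 xk; apply/idP/idP => [/eqP e|xk1].
  by rewrite e subr0 in xpi.
have piW : gr_pi a k x \in zpow Z a k.+1 by rewrite -(subKr x (gr_pi a k x)) memvB.
rewrite -memv0 -(capv_diff (zpow Z a k) (zpow Z a k.+1)) memv_cap piW andbT.
exact: memv_pi.
Qed.

Lemma gr_pi_id a k x : x \in gr_comp a k -> gr_pi a k x = x.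
Proof. by move=> xk; apply: daddv_pi_id => //; apply: capv_diff. Qed.

Definition graded_product : Prop :=
  forall a b (i j : nat), (0 < i)%N -> (0 < j)%N ->
  (sprod (zpow Z a i) (zpow Z b j) <= zpow Z (a (+) b) (i + j))%VS.

Definition gr_classf a (i : 'I_N) (x : Z) : {ffun 'I_N -> Z} :=
  [ffun k => if k == i then gr_pi a k.+1 x else 0].

Lemma gr_classf_mem a i x : gr_classf a i x \in gr_space a.
Proof.
by apply/mem_gr_space => k; rewrite ffunE; case: eqP => _; [apply: memv_pi|apply: mem0v].
Qed.

(* The class of x \in Z_a^(i+1), as an element of the summand of degree i+1. *)
Definition gr_class a i x : subvs_of (gr_space a) := Subvs (gr_classf_mem a i x).

(* The product of gr(Z) is induced by the product of Z. *)
Lemma gr_mul_class a b (i j k : 'I_N) x y :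
    graded_product -> (i.+1 + j.+1 = k.+1)%N ->
    x \in zpow Z a i.+1 -> y \in zpow Z b j.+1 ->
  gr_mul (gr_class a i x) (gr_class b j y) = gr_class (a (+) b) k (smul Z x y).
Proof.
move=> grP ijk xi yj; apply/val_inj/ffunP => l; rewrite /= !ffunE.
have smul_in c d p q u v : (0 < p)%N -> (0 < q)%N -> u \in zpow Z c p ->
    v \in zpow Z d q -> smul Z u v \in zpow Z (c (+) d) (p + q)%N.
  by move=> p0 q0 up vq; apply: (sprodP _ _ _ (grP c d p q p0 q0)).
case: (l =P k) => [->|nlk]; last first.
  rewrite big1 ?linear0 // => i' _; rewrite big1 // => j' /eqP e; rewrite !ffunE.
  case: eqP => [ei|_]; last by rewrite linear0l.
  case: eqP => [ej|_]; last by rewrite linear0r.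
  by case: nlk; apply/val_inj/eq_add_S; rewrite -e -ijk ei ej.
rewrite (bigD1 i) //= [X in _ + X]big1 ?addr0; last first.
  by move=> i' /negPf ni; rewrite big1 // => j' _; rewrite ffunE ni linear0l.
rewrite (bigD1 j) ?ijk //= [X in _ + X]big1 ?addr0; last first.
  by move=> j' /andP[_ /negPf nj]; rewrite [X in smul Z _ X]ffunE nj linear0r.
rewrite !ffunE !eqxx; apply/eqP; rewrite -subr_eq0 -linearB /=.
have pi_in c p u : (0 < p)%N -> u \in zpow Z c p -> gr_pi c p u \in zpow Z c p.
  move=> p0 up; apply: subvP (memv_pi _ _ _); exact: diffvSl.
have xpi := gr_pi_sub (ltn0Sn i) xi; have ypi := gr_pi_sub (ltn0Sn j) yj.
set px := gr_pi a i.+1 x in xpi *; set py := gr_pi b j.+1 y in ypi *.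
have dW : smul Z px py - smul Z x y \in zpow Z (a (+) b) k.+2.
  have -> : smul Z px py - smul Z x y =
            - (smul Z (x - px) y + smul Z px (y - py)).
    by rewrite linearBl linearBr addrA subrK opprB.
  rewrite memvN memvD //.
    by rewrite -ijk -addSn; apply: smul_in.
  by rewrite -ijk -addnS; apply: smul_in => //; apply: pi_in.
by rewrite gr_pi_eq0 ?dW //; apply: subvP dW; apply: zpow_subS.
Qed.

Definition naturally_graded : Prop := graded_product /\ superalgebra_iso Z gr.

End AssociatedGraded.

Section Models.
Variables (K : fieldType) (n m : nat).

(* The p-th standard basis vector, numbered from 1; it is 0 when p > d. *)
Definition bvec (d p : nat) : 'rV[K]_d := \row_j (j.+1 == p)%N%:R.

Definition bilin_ext (p q d : nat) (T : nat -> nat -> 'rV[K]_d)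
    (u : 'rV[K]_p) (v : 'rV[K]_q) : 'rV[K]_d :=
  \sum_(i < p) \sum_(j < q) (u 0 i * v 0 j) *: T i.+1 j.+1.

Lemma bilin_ext_bilinear p q d T :
  bilinear_for *:%R *:%R (@bilin_ext p q d T).
Proof.
split=> w a x y /=; rewrite /bilin_ext scaler_sumr -big_split /=;
apply: eq_bigr => i _; rewrite scaler_sumr -big_split /=;
apply: eq_bigr => j _; rewrite !mxE scalerA -scalerDl.
  by rewrite mulrDl mulrA.
by rewrite mulrDr mulrCA.
Qed.

HB.instance Definition _ p q d T :=
  bilinear_isBilinear.Build K 'rV[K]_p 'rV[K]_q 'rV[K]_d *:%R *:%R
    (@bilin_ext p q d T) (@bilin_ext_bilinear p q d T).

Lemma bilin_ext_bvec p q d T i j :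
  (0 < i <= p)%N -> (0 < j <= q)%N ->
  @bilin_ext p q d T (bvec p i) (bvec q j) = T i j.
Proof.
case: i => // i /=; case: j => // j /= lti ltj; rewrite /bilin_ext.
rewrite (bigD1 (Ordinal lti)) //= (bigD1 (Ordinal ltj)) //= !mxE !eqxx mulr1 scale1r.
rewrite !big1 ?addr0 // => [k nk | k nk]; last first.
  by rewrite !mxE eqSS (negPf nk : (k == j :> nat) = false) mulr0 scale0r.
by rewrite big1 // => l _; rewrite !mxE eqSS (negPf nk : (k == i :> nat) = false) mul0r scale0r.
Qed.

(* The superalgebra with even basis e_1, ..., e_n, odd basis f_1, ..., f_m and
   products e_i e_j = ee i j, e_i f_j = ef i j, f_j e_i = fe j i,
   f_i f_j = ff i j. *)
Definition table_superalgebra (ee : nat -> nat -> 'rV[K]_n)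
    (ef fe : nat -> nat -> 'rV[K]_m) (ff : nat -> nat -> 'rV[K]_n) :=
  pair_superalgebra (@bilin_ext n n n ee) (@bilin_ext n m m ef)
                    (@bilin_ext m n m fe) (@bilin_ext m m n ff).

(* The tables below are only read at indices >= 1; [bvec m p] is 0 for p > m,
   in accordance with the convention f_p = 0. *)
Local Notation e_ := (bvec n).
Local Notation f_ := (bvec m).

Definition star_ee (i j : nat) : 'rV[K]_n :=
  if (i + j <= n.-1)%N then 'C((i + j).-1, j)%:R *: e_ (i + j)%N else 0.

Definition star_ef (alpha : K) (i j : nat) : 'rV[K]_m :=
  if (i <= n.-1)%N then
    ((\prod_(0 <= k < i.-1) (alpha + j%:R + k%:R)) / (i.-1)`!%:R) *: f_ (j + i)%N
  else 0.

Definition star_fe (alpha : K) (j i : nat) : 'rV[K]_m :=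
  if (i <= n.-1)%N then
    ((\prod_(0 <= k < i) (alpha + j%:R + k%:R - 1)) / i`!%:R) *: f_ (j + i)%N
  else 0.

Definition single (d a b : nat) (v : 'rV[K]_d) (i j : nat) : 'rV[K]_d :=
  if (i == a) && (j == b) then v else 0.

(* [single] is only added at entries where the star tables vanish. *)
Definition nf1 := table_superalgebra star_ee
  (fun i j => star_ef (-1) i j + single n 1 (f_ 2) i j)
  (fun j i => star_fe (-1) j i + single 1 n (- f_ 2) j i)
  (fun _ _ => 0).

Definition nf2 (alpha : K) := table_superalgebra star_ee
  (star_ef alpha) (star_fe alpha) (fun _ _ => 0).

Definition nf3 := table_superalgebra star_ee
  (fun i j => star_ef (2%:R - m%:R) i j + single n m.-1 (f_ m) i j)
  (star_fe (2%:R - m%:R))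
  (fun _ _ => 0).

Definition nf4 := table_superalgebra star_ee
  (star_ef (3%:R - n%:R)) (star_fe (3%:R - n%:R))
  (single 1 (n - 2) (e_ n.-1)).

Definition nf5 := table_superalgebra star_ee
  (fun i j => star_ef (3%:R - n%:R) i j + single n (n - 2) (f_ n.-1) i j)
  (star_fe (3%:R - n%:R))
  (single 1 (n - 2) (e_ n.-1)).

End Models.

(* Main.v *)
(* The filtrations of gr(Z) reach 0, so by the isomorphism those of Z do, and
   L_x is nilpotent for the characteristic element x; its
   Jordan form then gives one-dimensional homogeneous pieces of gr(Z), spanned
   by the classes of iterates L_x^k v and L_x^k f, except for a two-dimensional
   even piece of degree 1. It therefore suffices to classify gr(Z), where every
   product of basis vectors is a scalar multiple of a basis vector. As n >= 5,
   the degree 1 part e_1 of x satisfies e_1 e_1 <> 0, and the Zinbiel identity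
   applied to triples containing e_1 expresses all products through
   alpha (f_1 e_1 = alpha f_2), the two coefficients in e_n f_1 = eps1 f_2 and
   e_n f_(m-1) = eps2 f_m, and the coefficient in f_1 f_(n-2) = gam e_(n-1), with
     (alpha + 1) eps1 = (alpha + m - 2) eps2 = (alpha + n - 3) gam = 0.
   Rescaling e_n and the f_j turns the nonzero coefficients into 1. *)
Require Import Defs.
From mathcomp Require Import all_boot all_order all_algebra.
From mathcomp Require Import complex reals.
From HB Require Import structures.
From mathcomp Require Import zify ring.
Import Order.TTheory GRing.Theory Num.Theory.
Local Open Scope ring_scope.

Set Implicit Arguments.
Unset Strict Implicit.
Unset Printing Implicit Defensive.

(** * Isomorphisms and multiplication tables *)

Section Bilinearity.
Variables (K : fieldType) (Z : superalgebra K).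
Implicit Types x y z : Z.

Lemma smulDl x y z : smul Z (x + y) z = smul Z x z + smul Z y z.
Proof. exact: linearDl. Qed.
Lemma smulDr x y z : smul Z x (y + z) = smul Z x y + smul Z x z.
Proof. exact: linearDr. Qed.
Lemma smulZl c x y : smul Z (c *: x) y = c *: smul Z x y.
Proof. exact: linearZl_LR. Qed.
Lemma smulZr c x y : smul Z x (c *: y) = c *: smul Z x y.
Proof. exact: linearZr_LR. Qed.
Lemma smul0l x : smul Z 0 x = 0.
Proof. exact: linear0l. Qed.
Lemma smul0r x : smul Z x 0 = 0.
Proof. exact: linear0r. Qed.

End Bilinearity.

Section Isomorphisms.
Variable K : fieldType.
Implicit Types A B C : superalgebra K.

Lemma superalgebra_iso_sym A B : superalgebra_iso A B -> superalgebra_iso B A.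
Proof.
case=> phi [/eqP kphi iphi hphi mphi].
have phiK := lker0_lfunK kphi.
have phiVK y : phi (phi^-1%VF y) = y by apply: limg_lfunVK; rewrite iphi memvf.
exists (phi^-1)%VF; split=> [||a|x y].
- by apply/eqP/lker0P/(can_inj phiVK).
- apply/eqP; rewrite eqEsubv subvf; apply/subvP => x _.
  by rewrite -[x]phiK memv_img ?memvf.
- by rewrite -hphi -limg_comp lker0_compVf // lim1g.
- by rewrite -{1}[x]phiVK -{1}[y]phiVK -mphi phiK.
Qed.

Lemma superalgebra_iso_trans A B C :
  superalgebra_iso A B -> superalgebra_iso B C -> superalgebra_iso A C.
Proof.
case=> phi [/eqP kphi iphi hphi mphi] [psi [/eqP kpsi ipsi hpsi mpsi]].
exists (psi \o phi)%VF; split=> [||a|x y].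
- apply/eqP/lker0P => x y; rewrite !comp_lfunE.
  by move/(lker0P kpsi)/(lker0P kphi).
- by rewrite limg_comp iphi.
- by rewrite limg_comp hphi hpsi.
- by rewrite !comp_lfunE mphi mpsi.
Qed.

Lemma zinbiel_iso A B : superalgebra_iso A B -> zinbiel A -> zinbiel B.
Proof.
case=> phi [_ _ hphi mphi] zA a b c x y z.
rewrite -!hphi => /memv_imgP[x' xa ->] /memv_imgP[y' yb ->] /memv_imgP[z' zc ->].
by rewrite -!mphi -linearZ -linearD -!mphi (zA a b c).
Qed.

End Isomorphisms.

(** * Superalgebras given by a multiplication table *)

Section Tables.
Variables (K : fieldType) (B : superalgebra K).

Definition vec d (X : nat -> B) (u : 'rV[K]_d) : B := \sum_(i < d) u 0 i *: X i.+1.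

Lemma vec_linear d X : linear (@vec d X).
Proof.
move=> c u v; rewrite /vec scaler_sumr -big_split; apply: eq_bigr => i _.
by rewrite /= !mxE scalerA -scalerDl.
Qed.
HB.instance Definition _ d X :=
  GRing.isLinear.Build K 'rV[K]_d B *:%R (@vec d X) (vec_linear X).

Lemma vec_bvec d X p : (0 < p <= d)%N -> vec X (bvec K d p) = X p.
Proof.
case: p => // p /= ltp; rewrite /vec (bigD1 (Ordinal ltp)) //= mxE eqxx scale1r.
rewrite big1 ?addr0 // => i ni.
by rewrite mxE eqSS (negPf ni : (i == p :> nat) = false) scale0r.
Qed.

Lemma bvec_gt d p : (d < p)%N -> bvec K d p = 0.
Proof.
by move=> ltdp; apply/rowP => j; rewrite !mxE (ltn_eqF (leq_ltn_trans (ltn_ord j) ltdp)).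
Qed.

Lemma vec_bilin_ext p q d (X Y W : nat -> B) T (u : 'rV[K]_p) (v : 'rV[K]_q) :
  (forall i j, (0 < i <= p)%N -> (0 < j <= q)%N ->
     smul B (X i) (Y j) = vec W (T i j : 'rV[K]_d)) ->
  vec W (bilin_ext T u v) = smul B (vec X u) (vec Y v).
Proof.
move=> TE; rewrite linear_sumlz /= linear_sum; apply: eq_bigr => i _.
rewrite linear_sumr linear_sum; apply: eq_bigr => j _ /=.
by rewrite linearZl_LR linearZr_LR linearZ /= scalerA TE ?ltn_ord.
Qed.

(** The isomorphism is built in the opposite direction: a pair (u, v) of coordinate rows goes to
    [vec E u + vec F v]. The two bases make it bijective and even, and the product formulas extend
    from basis vectors by bilinearity. *)
Lemma table_iso n m (E F : nat -> B)
    (ee : nat -> nat -> 'rV[K]_n) (ef fe : nat -> nat -> 'rV[K]_m)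
    (ff : nat -> nat -> 'rV[K]_n) :
  basis_of (homog B false) [tuple E i.+1 | i < n] ->
  basis_of (homog B true) [tuple F i.+1 | i < m] ->
  (forall i j, (0 < i <= n)%N -> (0 < j <= n)%N ->
     smul B (E i) (E j) = vec E (ee i j)) ->
  (forall i j, (0 < i <= n)%N -> (0 < j <= m)%N ->
     smul B (E i) (F j) = vec F (ef i j)) ->
  (forall i j, (0 < i <= m)%N -> (0 < j <= n)%N ->
     smul B (F i) (E j) = vec F (fe i j)) ->
  (forall i j, (0 < i <= m)%N -> (0 < j <= m)%N ->
     smul B (F i) (F j) = vec E (ff i j)) ->
  superalgebra_iso B (table_superalgebra ee ef fe ff).
Proof.
move=> bE bF hee hef hfe hff; apply: superalgebra_iso_sym.
have vec_inj d (X : nat -> B) (u : 'rV_d) :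
    free [tuple X i.+1 | i < d] -> vec X u = 0 -> u = 0.
  move=> /freeP fX u0; apply/rowP => j; rewrite mxE.
  apply: (fX (fun i => u 0 i)); rewrite -{}[RHS]u0; apply: eq_bigr => i _.
  by rewrite (nth_map i) ?size_enum_ord ?nth_ord_enum.
have vec_surj d (X : nat -> B) U v :
    basis_of U [tuple X i.+1 | i < d] -> v \in U -> exists u : 'rV_d, v = vec X u.
  move=> bX /(coord_basis bX) ->; exists (\row_i coord [tuple X i.+1 | i < d] i v).
  apply: eq_bigr => i _; rewrite mxE.
  by rewrite (nth_map i) ?size_enum_ord ?nth_ord_enum.
have vec_mem d (X : nat -> B) U (u : 'rV_d) :
    basis_of U [tuple X i.+1 | i < d] -> vec X u \in U.
  move=> bX; apply: memv_suml => i _; apply/memvZ/(basis_mem bX).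
  by apply/mapP; exists i; rewrite ?mem_enum.
pose A := table_superalgebra ee ef fe ff.
pose psi (p : A) : B := vec E p.1 + vec F p.2.
have psi_lin : linear psi.
  by move=> c p q; rewrite /psi !linearP scalerDr -!addrA; congr (_ + _); rewrite addrCA.
pose psiL := GRing.isLinear.Build K A B *:%R psi psi_lin.
pose psi' : {linear A -> B} := HB.pack psi psiL.
have psiE p : linfun psi' p = vec E p.1 + vec F p.2 by rewrite lfunE.
have disj u v : u \in homog B false -> v \in homog B true -> u + v = 0 -> u = 0.
  move=> u0 v1 /eqP; rewrite addr_eq0 => /eqP uv; apply/eqP; rewrite -memv0.
  by rewrite -(homog_cap B) memv_cap u0 uv memvN.
exists (linfun psi'); split.
- apply/eqP; rewrite -subv0; apply/subvP => -[u v]; rewrite memv_ker psiE /= => /eqP uv.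
  have u0 := disj _ _ (vec_mem _ _ _ _ bE) (vec_mem _ _ _ _ bF) uv.
  move: uv; rewrite u0 add0r => /(vec_inj _ _ _ (basis_free bF)) ->.
  by rewrite (vec_inj _ _ _ (basis_free bE) u0) mem0v.
- apply/eqP; rewrite eqEsubv subvf -(homog_full B); apply/subvP => _ /memv_addP[x x0 [y y1 ->]].
  have [u ->] := vec_surj _ _ _ _ bE x0; have [v ->] := vec_surj _ _ _ _ bF y1.
  by rewrite -(psiE (u, v)) memv_img ?memvf.
- move=> a; apply/eqP; rewrite eqEsubv; apply/andP; split; apply/subvP => x.
    case/memv_imgP=> -[u v]; rewrite psiE /= mem_pair_homog => + ->.
    case: a => /= /eqP->; rewrite linear0 ?add0r ?addr0.
      exact: vec_mem bF.
    exact: vec_mem bE.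
  case: a => xa.
    have [v ->] := vec_surj _ _ _ _ bF xa; apply/memv_imgP; exists (0, v).
      by rewrite mem_pair_homog /=.
    by rewrite psiE /= linear0 add0r.
  have [u ->] := vec_surj _ _ _ _ bE xa; apply/memv_imgP; exists (u, 0).
    by rewrite mem_pair_homog /=.
  by rewrite psiE /= linear0 addr0.
- move=> [u v] [u' v']; rewrite !psiE /= !linearD /=.
  rewrite (vec_bilin_ext _ _ hee) (vec_bilin_ext _ _ hef).
  rewrite (vec_bilin_ext _ _ hfe) (vec_bilin_ext _ _ hff).
  rewrite !smulDl -!addrA; congr (_ + _).
  by rewrite addrC [X in X + _]addrC -addrA.
Qed.

End Tables.

(** * Products in normal form *)

(** Generalised binomials: for i >= 1 and N = alpha + j + i - 2, [ef_coef] is N choose i - 1 and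
    [fe_coef] is N choose i. By Pascal's rule their sum is [ef_coef] at i + 1. *)
Definition ef_coef (K : fieldType) (alpha : K) i j : K :=
  (\prod_(0 <= k < i.-1) (alpha + j%:R + k%:R)) / (i.-1)`!%:R.
Definition fe_coef (K : fieldType) (alpha : K) j i : K :=
  (\prod_(0 <= k < i) (alpha + j%:R + k%:R - 1)) / i`!%:R.

Section NormalForm.
Variables (K : numClosedFieldType) (B : superalgebra K) (n m : nat).
Local Notation "x ** y" := (smul B x y) (at level 40, left associativity).

(** The indices have no upper bound: in an adapted basis the chains vanish beyond their length, so
    truncation is automatic. Relations among the four parameters are kept separate. *)
Record normal_products (e f : nat -> B) (w : B) (alpha eps1 eps2 gam : K) : Prop :=
  NormalProducts {
    np_ee : forall i j, (0 < i)%N -> (0 < j)%N ->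
      e i ** e j = 'C((i + j).-1, j)%:R *: e (i + j)%N;
    np_ew : forall i, (0 < i)%N -> e i ** w = 0;
    np_we : forall i, (0 < i)%N -> w ** e i = 0;
    np_ww : w ** w = 0;
    np_ef : forall i j, (0 < i)%N -> (0 < j)%N ->
      e i ** f j = ef_coef alpha i j *: f (j + i)%N;
    np_fe : forall i j, (0 < i)%N -> (0 < j)%N ->
      f j ** e i = fe_coef alpha j i *: f (j + i)%N;
    np_wf : forall j, (0 < j)%N -> w ** f j =
      if j == 1%N then eps1 *: f 2 else if j == m.-1 then eps2 *: f m else 0;
    np_fw : forall j, (0 < j)%N -> f j ** w = if j == 1%N then - eps1 *: f 2 else 0;
    np_ff : forall i j, (0 < i)%N -> (0 < j)%N -> f i ** f j =
      if (i == 1%N) && (j == n - 2)%N then gam *: e n.-1 else 0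
  }.

(* w plays the role of e_n, because the chain e is required to vanish from n on. *)
Definition even_basis (e : nat -> B) (w : B) (k : nat) : B := if k == n then w else e k.

Record adapted_basis (e f : nat -> B) (w : B) : Prop := AdaptedBasis {
  ab_even : basis_of (homog B false) [tuple even_basis e w i.+1 | i < n];
  ab_odd : basis_of (homog B true) [tuple f i.+1 | i < m];
  ab_e0 : forall k, (n <= k)%N -> e k = 0;
  ab_f0 : forall k, (m < k)%N -> f k = 0
}.

Lemma basis_of_scale d (U : {vspace B}) (X Y : nat -> B) (c : nat -> K) :
  (forall i, c i != 0) -> (forall i, Y i = c i *: X i) ->
  basis_of U [tuple X i.+1 | i < d] -> basis_of U [tuple Y i.+1 | i < d].
Proof.
move=> c0 YE bX; rewrite basisEdim size_tuple (size_basis bX) leqnn andbT.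
rewrite -[X in (X <= _)%VS](span_basis bX); apply/span_subvP => x /mapP[i _ ->].
have -> : X i.+1 = (c i.+1)^-1 *: Y i.+1 by rewrite YE scalerA mulVf ?scale1r.
by apply/memvZ/memv_span/mapP; exists i; rewrite ?mem_enum.
Qed.

(** Mixed products are linear in the f_j, so a common factor s leaves their coefficients alone;
    products of two f's are quadratic in it, and those with [w] are linear in t. *)
Lemma normal_products_scale e f w alpha eps1 eps2 gam s t :
  s != 0 -> t != 0 -> adapted_basis e f w ->
  normal_products e f w alpha eps1 eps2 gam ->
  adapted_basis e (fun k => s *: f k) (t *: w) /\
  normal_products e (fun k => s *: f k) (t *: w) alpha (t * eps1) (t * eps2) (s ^+ 2 * gam).
Proof.
move=> s0 t0 [bE bF e0 f0] [ee ew we ww ef fe wf fw ff]; split; split=> //.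
- apply: (basis_of_scale (c := fun i => if i == n then t else 1) _ _ bE) => i.
    by case: (i == n); rewrite ?oner_eq0.
  by rewrite /even_basis; case: eqP; rewrite ?scale1r.
- exact: (basis_of_scale (c := fun=> s) (fun=> s0) (fun=> erefl) bF).
- by move=> k /f0->; rewrite scaler0.
- by move=> i /ew E; rewrite smulZr E scaler0.
- by move=> i /we E; rewrite smulZl E scaler0.
- by rewrite smulZl smulZr ww !scaler0.
- by move=> i j i0 j0; rewrite smulZr ef // !scalerA mulrC.
- by move=> i j i0 j0; rewrite smulZl fe // !scalerA mulrC.
- move=> j j0; rewrite smulZl smulZr wf //.
  by case: ifP => _; [|case: ifP => _]; rewrite ?scaler0 // !scalerA; congr (_ *: _); ring.
- move=> j j0; rewrite smulZl smulZr fw //.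
  by case: ifP => _; rewrite ?scaler0 // !scalerA; congr (_ *: _); ring.
- move=> i j i0 j0; rewrite smulZl smulZr ff //.
  by case: ifP => _; rewrite ?scaler0 // !scalerA; congr (_ *: _); ring.
Qed.

(** The tables match the products once index n is read as [w] and the cut-off in [star_ee] as the
    vanishing of [e k] for k >= n. *)
Lemma normal_iso e f w alpha eps1 eps2 gam
    (ef fe : nat -> nat -> 'rV[K]_m) (ff : nat -> nat -> 'rV[K]_n) :
  (4 < n)%N -> (3 < m)%N ->
  adapted_basis e f w -> normal_products e f w alpha eps1 eps2 gam ->
  (forall i j, (0 < i <= n)%N -> (0 < j <= m)%N -> ef i j =
     star_ef n m alpha i j + single n 1 (eps1 *: bvec K m 2) i j
       + single n m.-1 (eps2 *: bvec K m m) i j) ->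
  (forall j i, (0 < j <= m)%N -> (0 < i <= n)%N -> fe j i =
     star_fe n m alpha j i + single 1 n (- eps1 *: bvec K m 2) j i) ->
  (forall i j, (0 < i <= m)%N -> (0 < j <= m)%N -> ff i j =
     single 1 (n - 2) (gam *: bvec K n n.-1) i j) ->
  superalgebra_iso B (table_superalgebra (star_ee K n) ef fe ff).
Proof.
move=> n5 m4 [bE bF e0 f0] [ee ew we ww ef' fe' wf fw ff'] efE feE ffE.
have vecf p : (0 < p)%N -> vec f (bvec K m p) = f p.
  move=> p0; case: (leqP p m) => pm; first by rewrite vec_bvec ?p0.
  by rewrite bvec_gt // linear0 f0.
have vece p : (0 < p < n)%N -> vec (even_basis e w) (bvec K n p) = e p.
  case/andP=> p0 pn; rewrite vec_bvec ?p0 1?ltnW //.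
  by rewrite /even_basis (ltn_eqF pn).
apply: (table_iso bE bF) => i j /andP[i0 i_le] /andP[j0 j_le]; rewrite /even_basis.
- rewrite /star_ee; case: (i =P n) => [ei|ni].
    rewrite (_ : (i + j <= n.-1)%N = false) ?linear0; last lia.
    by case: eqP => _; rewrite ?ww ?we.
  case: (j =P n) => [ej|nj].
    by rewrite (_ : (i + j <= n.-1)%N = false) ?linear0 ?ew //; lia.
  rewrite ee //; case: ifP => le; last by rewrite linear0 e0 ?scaler0 //; lia.
  by rewrite linearZ /= vece //; lia.
- rewrite efE ?i0 ?j0 // /star_ef /single !linearD /=; case: (i =P n) => [ei|ni].
    rewrite (_ : (i <= n.-1)%N = false) ?linear0 ?add0r; last lia.
    rewrite wf //=; case: eqP => [j1|j1] /=.
      rewrite (_ : (j == m.-1) = false); last lia.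
      by rewrite linear0 addr0 linearZ /= vecf.
    rewrite linear0 add0r; case: eqP => _; last by rewrite linear0.
    by rewrite linearZ /= vecf //; lia.
  rewrite (_ : (i <= n.-1)%N) /=; last lia.
  by rewrite linear0 !addr0 linearZ /= vecf ?ef' //; lia.
- rewrite feE ?i0 ?j0 // /star_fe /single linearD /=; case: (j =P n) => [ej|nj].
    rewrite (_ : (j <= n.-1)%N = false) ?linear0 ?add0r; last lia.
    rewrite fw // andbT; case: eqP => _; last by rewrite linear0.
    by rewrite linearZ /= vecf.
  rewrite (_ : (j <= n.-1)%N) /=; last lia.
  by rewrite andbF linear0 addr0 linearZ /= vecf ?fe' //; lia.
- rewrite ffE ?i0 ?j0 // /single ff' //; case: ifP => _; last by rewrite linear0.
  by rewrite linearZ /= vece //; lia.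
Qed.

Lemma adapted_e_neq0 e f w k : adapted_basis e f w -> (0 < k < n)%N -> e k != 0.
Proof.
case: k => // k [bE _ _ _] /= ltkn.
rewrite -[e _]/(if false then w else e k.+1) -(ltn_eqF ltkn).
apply/(basis_not0 bE)/mapP; exists (Ordinal (ltnW ltkn)); rewrite ?mem_enum //.
Qed.

Lemma adapted_f_neq0 e f w k : adapted_basis e f w -> (0 < k <= m)%N -> f k != 0.
Proof.
case: k => // k [_ bF _ _] /= ltkm.
by apply/(basis_not0 bF)/mapP; exists (Ordinal ltkm); rewrite ?mem_enum.
Qed.

(** Nonzero eps1, eps2, gam force alpha to be -1, 2 - m, 3 - n respectively. As n > 4 and m > 3,
    eps1 cannot coexist with gam or eps2, while eps2 and gam coexist only for m = n - 1. *)
Lemma normal_products_classify e f w alpha eps1 eps2 gam :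
  (4 < n)%N -> (3 < m)%N ->
  adapted_basis e f w -> normal_products e f w alpha eps1 eps2 gam ->
  (alpha + 1) * eps1 = 0 -> (alpha + m%:R - 2%:R) * eps2 = 0 ->
  (alpha + n%:R - 3%:R) * gam = 0 ->
  [\/ superalgebra_iso B (nf1 K n m),
      (exists alpha : K, superalgebra_iso B (nf2 n m alpha)),
      superalgebra_iso B (nf3 K n m)
    | (n - 2 <= m)%N /\
      (superalgebra_iso B (nf4 K n m) \/ superalgebra_iso B (nf5 K n m))].
Proof.
move=> n5 m4 bB np /eqP + /eqP + /eqP; rewrite !mulf_eq0 => r1 r2 r3.

have natE (a b : nat) : (a%:R == b%:R :> K) = (a == b) by rewrite eqr_nat.
have [gam0|gam_neq0] := eqVneq gam 0; last first.
  have alphaE : alpha = 3%:R - n%:R.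
    apply/eqP; rewrite -subr_eq0.
    by move: r3; rewrite (negPf gam_neq0) orbF opprB addrA.
  have eps1_0 : eps1 = 0.
    apply/eqP; move: r1; rewrite alphaE orbC; case: eqP => //= _.
    by rewrite addrAC natr1 subr_eq0 natE => /eqP; lia.
  (* The coefficient gam is multiplied by s^2, so s is a square root of its inverse. *)
  have s0 : sqrtC gam^-1 != 0 by rewrite sqrtC_eq0 invr_eq0.
  have sE : sqrtC gam^-1 ^+ 2 * gam = 1 by rewrite sqrtCK mulVf.
  (* Otherwise f_(n-2) = 0, whereas f_1 f_(n-2) = gam e_(n-1) is nonzero. *)
  have nm : (n - 2 <= m)%N.
    rewrite leqNgt; apply/negP => ltmn; move/eqP: gam_neq0; apply.
    have := np_ff np (ltn0Sn 0) (_ : 0 < n - 2)%N.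
    rewrite (ab_f0 bB ltmn) smul0r !eqxx /=.
    move=> /(_ ltac:(lia))/esym/eqP; rewrite scaler_eq0 => /orP[/eqP//|].
    suff -> : (e n.-1 == 0) = false by [].
    by apply: negbTE; apply: adapted_e_neq0 bB _; lia.
  constructor 4; split=> //; subst eps1 alpha.
  have [eps20|eps2_neq0] := eqVneq eps2 0; [left|right].
    subst eps2; have [bB' np'] := normal_products_scale s0 (oner_neq0 K) bB np.
    apply: (normal_iso n5 m4 bB' np') => i j _ _.
    - by rewrite !mulr0 !scale0r /single; do 2 case: ifP => _;
         rewrite !addr0.
    - by rewrite mulr0 oppr0 scale0r /single; case: ifP => _; rewrite addr0.
    - by rewrite sE scale1r.
  (* Comparing alpha = 3 - n with alpha = 2 - m; then e_n f_(m-1) = f_m is the product e_n f_(n-2) =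
     f_(n-1) of [nf5]. *)
  have mE : m = n.-1.
    move: r2; rewrite (negPf eps2_neq0) orbF.
    have -> : 3%:R - n%:R + m%:R - 2%:R = (3 + m)%:R - (n + 2)%:R :> K.
      by rewrite !natrD; ring.
    by rewrite subr_eq0 natE => /eqP; lia.
  have [bB' np'] := normal_products_scale s0 (invr_neq0 eps2_neq0) bB np.
  apply: (normal_iso n5 m4 bB' np') => i j _ _.
  - rewrite mulr0 scale0r mulVf // scale1r /single.
    have -> : (n - 2)%N = m.-1 by lia.
    have -> : n.-1 = m by [].
    by rewrite if_same addr0.
  - by rewrite mulr0 oppr0 scale0r /single; case: ifP => _; rewrite addr0.
  - by rewrite sE scale1r.
subst gam.
have [eps10|eps1_neq0] := eqVneq eps1 0; last first.
  have alphaE : alpha = -1.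
    by apply/eqP; rewrite -subr_eq0 opprK; move: r1; rewrite (negPf eps1_neq0) orbF.
  have eps2_0 : eps2 = 0.
    apply/eqP; move: r2; rewrite alphaE orbC; case: eqP => //= _.
    have -> : -1 + m%:R - 2%:R = m%:R - 3%:R :> K by ring.
    by rewrite subr_eq0 natE => /eqP; lia.
  subst alpha eps2; constructor 1.
  have [bB' np'] := normal_products_scale (oner_neq0 K) (invr_neq0 eps1_neq0) bB np.
  apply: (normal_iso n5 m4 bB' np') => i j _ _.
  - rewrite mulr0 scale0r mulVf // scale1r /single.
    by case: ifP => _; case: ifP => _; rewrite !addr0.
  - by rewrite mulVf // scaleN1r.
  - by rewrite mulr0 scale0r /single; case: ifP.
subst eps1.
have [eps20|eps2_neq0] := eqVneq eps2 0.
  subst eps2; constructor 2; exists alpha.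
  apply: (normal_iso n5 m4 bB np) => i j _ _.
  - by rewrite !scale0r /single; do 2 case: ifP => _; rewrite !addr0.
  - by rewrite oppr0 scale0r /single; case: ifP => _; rewrite addr0.
  - by rewrite scale0r /single; case: ifP.
have alphaE : alpha = 2%:R - m%:R.
  by apply/eqP; rewrite -subr_eq0; move: r2; rewrite (negPf eps2_neq0) orbF opprB addrA.
subst alpha; constructor 3.
have [bB' np'] := normal_products_scale (oner_neq0 K) (invr_neq0 eps2_neq0) bB np.
apply: (normal_iso n5 m4 bB' np') => i j _ _.
- rewrite mulr0 scale0r mulVf // scale1r /single.
  by case: ifP => _; case: ifP => _; rewrite ?addr0.
- by rewrite mulr0 oppr0 scale0r /single; case: ifP => _; rewrite addr0.
- by rewrite mulr0 scale0r /single; case: ifP.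
Qed.

End NormalForm.

(** * Solving the Zinbiel identity on a graded basis *)

Section GradedZinbiel.
Variables (K : numClosedFieldType) (B : superalgebra K) (n m : nat).
Local Notation "x ** y" := (smul B x y) (at level 40, left associativity).
Hypothesis zB : zinbiel B.

Lemma zinbiel_even a b c (x y z : B) : ~~ (b && c) ->
  x \in homog B a -> y \in homog B b -> z \in homog B c ->
  (x ** y) ** z = x ** (y ** z + z ** y).
Proof. by move=> /negPf bc xa yb zc; rewrite (zB xa yb zc) bc scale1r. Qed.

Lemma zinbiel_odd a (x y z : B) :
  x \in homog B a -> y \in homog B true -> z \in homog B true ->
  (x ** y) ** z = x ** (y ** z - z ** y).
Proof. by move=> xa yb zc; rewrite (zB xa yb zc) expr1 scaleN1r. Qed.

Hypotheses (n5 : (4 < n)%N) (m4 : (3 < m)%N).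
Variables (e f : nat -> B) (w : B).
Hypothesis bB : adapted_basis n m e f w.
Hypotheses (e_even : forall k, e k \in homog B false)
  (w_even : w \in homog B false) (f_odd : forall k, f k \in homog B true).
Hypothesis eS : forall k, (0 < k)%N -> e 1 ** e k = e k.+1.
Hypothesis fS : forall k, (0 < k)%N -> e 1 ** f k = f k.+1.
Hypothesis ew1 : e 1 ** w = 0.
Hypotheses (we1_line : w ** e 1 \in <[e 2]>%VS) (ww_line : w ** w \in <[e 2]>%VS).
Hypothesis wf_line : forall k, (0 < k)%N -> w ** f k \in <[f k.+1]>%VS.
Hypothesis fw_line : f 1 ** w \in <[f 2]>%VS.
Hypothesis ff_line : forall i j, (0 < i)%N -> (0 < j)%N ->
  f i ** f j \in <[e (i + j)%N]>%VS.

Let e_neq0 k : (0 < k < n)%N -> e k != 0 := @adapted_e_neq0 _ _ _ _ _ _ _ _ bB.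
Let f_neq0 k : (0 < k <= m)%N -> f k != 0 := @adapted_f_neq0 _ _ _ _ _ _ _ _ bB.
Let e_ge k : (n <= k)%N -> e k = 0 := ab_e0 bB (k:=k).
Let f_gt k : (m < k)%N -> f k = 0 := ab_f0 bB (k:=k).

(** From e_(i+1) e_j = e_1 (e_i e_j + e_j e_i) the coefficients obey Pascal's rule. The induction is
    on i + j because the second summand swaps the indices. *)
Lemma ee_prod i j : (0 < i)%N -> (0 < j)%N ->
  e i ** e j = 'C((i + j).-1, j)%:R *: e (i + j)%N.
Proof.
have [s] := ubnP (i + j); elim: s i j => // s IHs [//|[|i]] j lt_s _ j0.
  by rewrite add1n /= binn scale1r eS.
rewrite -eS // (zinbiel_even _ (e_even _) (e_even _) (e_even _)) //.
rewrite !IHs //; try lia.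
rewrite addnC -scalerDl smulZr eS; last lia.
rewrite (_ : (j + i.+1).+1 = i.+2 + j)%N; last lia.
congr (_ *: _); rewrite -natrD; congr _%:R.
case: j j0 {lt_s} => // j _; rewrite (_ : (i.+2 + j.+1).-1 = (i + j.+1).+1)%N; last lia.
rewrite binS.
rewrite (_ : (j.+1 + i.+1).-1 = i + j.+1)%N; last lia.
by congr (_ + _)%N; rewrite -[LHS]bin_sub; [congr 'C(_, _); lia | lia].
Qed.

(** With w e_1 = c e_2, the triple (e_1, w, e_1) gives c e_3 = 0, and e_3 is nonzero. *)
Lemma we1 : w ** e 1 = 0.
Proof.
have /vlineP[c wE] := we1_line.
have := zinbiel_even (isT : ~~ (false && false)) (e_even 1) w_even (e_even 1).
rewrite ew1 smul0l addr0 wE smulZr eS // => /esym/eqP.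
rewrite scaler_eq0 (negPf (e_neq0 _)) ?orbF; last lia.
by move=> /eqP->; rewrite scale0r.
Qed.

(** With w w = c e_2, the triple (e_1, w, w) gives 2c e_3 = 0. *)
Lemma ww0 : w ** w = 0.
Proof.
have /vlineP[c wE] := ww_line.
have := zinbiel_even (isT : ~~ (false && false)) (e_even 1) w_even w_even.
rewrite ew1 smul0l wE -scalerDl smulZr eS // => /esym/eqP.
rewrite scaler_eq0 (negPf (e_neq0 _)) ?orbF; last lia.
by rewrite -mulr2n mulrn_eq0 /= => /eqP->; rewrite scale0r.
Qed.

(** The triple (w, e_1, e_(k-1)) gives 0 = k (w e_k) for k >= 2. *)
Lemma we0 k : (0 < k)%N -> w ** e k = 0.
Proof.
case: k => // [[|k]] _; first exact: we1.
have := zinbiel_even (isT : ~~ (false && false)) w_even (e_even 1) (e_even k.+1).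
rewrite we1 smul0l !ee_prod // add1n addn1 /= binn bin1 -scalerDl smulZr => /esym/eqP.
by rewrite scaler_eq0 -natrD pnatr_eq0 /= => /eqP.
Qed.

Lemma ew0 k : (0 < k)%N -> e k ** w = 0.
Proof.
elim: k => // [[|k]] IHk _; first exact: ew1.
rewrite -eS // (zinbiel_even _ (e_even _) (e_even _) w_even) //.
by rewrite IHk // we0 // addr0 smul0r.
Qed.

(** The triples (e_1, f_j, w) and (e_1, w, f_j) have the same right-hand side, so f_(j+1) w = (e_1
    f_j) w = (e_1 w) f_j = 0. *)
Lemma fw0 j : (0 < j)%N -> f j.+1 ** w = 0.
Proof.
move=> j0; rewrite -fS // (zinbiel_even _ (e_even _) (f_odd _) w_even) // addrC.
by rewrite -(zinbiel_even (b := false) (c := true) _ (e_even _) w_even (f_odd _)) // ew1 smul0l.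
Qed.

Lemma e1_wf_fw j : (0 < j)%N -> e 1 ** (w ** f j + f j ** w) = 0.
Proof.
move=> j0.
by rewrite -(zinbiel_even (b := false) (c := true) _ (e_even _) w_even (f_odd _)) // ew1 smul0l.
Qed.

(** Here f_j w = 0, so e_1 (w f_j) = 0. With w f_j = c f_(j+1) this reads c f_(j+2) = 0, which kills
    c when j + 2 <= m; for j >= m already f_(j+1) = 0. *)
Lemma wf0 j : (1 < j)%N -> j != m.-1 -> w ** f j = 0.
Proof.
move=> j1 nj; have /vlineP[c wfE] := wf_line (ltnW j1).
case: (leqP m j) => mj; first by rewrite wfE f_gt ?scaler0.
have := e1_wf_fw (ltnW j1); case: j j1 {mj} nj wfE (mj) => // j j1 nj wfE mj.
rewrite fw0 // addr0 wfE smulZr fS // => /eqP.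
rewrite scaler_eq0 (negPf (f_neq0 _)) ?orbF; last lia.
by move=> /eqP->; rewrite scale0r.
Qed.

(** The relation e_1 (w f_1 + f_1 w) = 0 lives in degree 3, where f_3 is nonzero. *)
Lemma fw1 : f 1 ** w = - (w ** f 1).
Proof.
have /vlineP[c wfE] := wf_line (ltn0Sn 0); have /vlineP[d fwE] := fw_line.
have := e1_wf_fw (ltn0Sn 0); rewrite wfE fwE -scalerDl smulZr fS // => /eqP.
rewrite scaler_eq0 (negPf (f_neq0 _)) ?orbF; last lia.
by rewrite addrC addr_eq0 -scaleNr => /eqP->.
Qed.

(** * Mixed and odd products in terms of alpha *)

Variable alpha : K.
Hypothesis fe11 : f 1 ** e 1 = alpha *: f 2.

(** Since f_(j+1) e_1 = e_1 (f_j e_1 + e_1 f_j), each step adds 1 to the coefficient. *)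
Lemma fe1_prod j : (0 < j)%N -> f j ** e 1 = (alpha + j%:R - 1) *: f j.+1.
Proof.
elim: j => // [[|j]] IHj _; first by rewrite fe11 addrK.
rewrite -{1}fS // (zinbiel_even _ (e_even _) (f_odd _) (e_even _)) //.
rewrite IHj // fS // -[X in _ + X]scale1r -scalerDl smulZr fS //.
by congr (_ *: _); rewrite -(natr1 j.+1); ring.
Qed.

(** The triple (f_j, e_1, e_(i-1)) gives (alpha + j - 1) f_(j+1) e_(i-1) = i (f_j e_i) for i >= 2;
    the induction divides by i. *)
Lemma fe_prod i j : (0 < i)%N -> (0 < j)%N ->
  f j ** e i = fe_coef alpha j i *: f (j + i)%N.
Proof.
elim: i j => // [[|i]] IHi j _ j0.
  rewrite fe1_prod // addn1 /fe_coef big_nat1 divr1; congr (_ *: _); ring.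
have := zinbiel_even (isT : ~~ (false && false)) (f_odd j) (e_even 1) (e_even i.+1).
rewrite fe1_prod // smulZl IHi // !ee_prod // add1n addn1 /= binn bin1.
rewrite -scalerDl smulZr -natrD add1n addSnnS => /esym/(canRL (scalerK _)) -> //; last first.
  by rewrite pnatr_eq0.
rewrite !scalerA; congr (_ *: _); rewrite /fe_coef [in RHS]big_nat_recl //.
rewrite (factS i.+1) natrM invfM addr0; set P := \prod_(_ <= _ < _) _.
rewrite (eq_bigr (fun k => alpha + j.+1%:R + k%:R - 1)); last first.
  by move=> k _; rewrite -(natr1 j) -(natr1 k); ring.
rewrite -/P. ring.
Qed.

(** From e_(i+1) f_j = e_1 (e_i f_j + f_j e_i), by Pascal's rule for generalised binomials. *)
Lemma ef_prod i j : (0 < i)%N -> (0 < j)%N ->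
  e i ** f j = ef_coef alpha i j *: f (j + i)%N.
Proof.
elim: i j => // [[|i]] IHi j _ j0.
  by rewrite fS // addn1 /ef_coef big_geq // divr1 scale1r.
rewrite -eS // (zinbiel_even _ (e_even _) (e_even _) (f_odd _)) //.
rewrite IHi // fe_prod // -scalerDl smulZr fS; last lia.
rewrite !addnS; congr (_ *: _).
rewrite /ef_coef /fe_coef /= [in RHS]big_nat_recr //= [X in _ + X / _]big_nat_recl //.
rewrite addr0 factS natrM; set P := \prod_(_ <= _ < _) _.
rewrite (eq_bigr (fun k => alpha + j%:R + k%:R)) -/P; last first.
  by move=> k _; rewrite -(natr1 k); ring.
have i0 : i.+1%:R != 0 :> K by rewrite pnatr_eq0.
have f0 : i`!%:R != 0 :> K by rewrite pnatr_eq0 -lt0n fact_gt0.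
rewrite -(natr1 i); field.
by rewrite f0 natr1 i0.
Qed.

(** The triple (w, f_1, e_1) compares (w f_1) e_1 = eps (alpha + 1) f_3 with (alpha + 1) w f_2,
    which is 0 because 2 differs from m - 1. *)
Lemma eps1_rel eps : w ** f 1 = eps *: f 2 -> (alpha + 1) * eps = 0.
Proof.
move=> wf1.
have := zinbiel_even (isT : ~~ (true && false)) w_even (f_odd 1) (e_even 1).
rewrite fS // fe11 -[X in _ + X]scale1r -scalerDl smulZr (wf0 (j := 2)) //; last lia.
rewrite wf1 smulZl fe1_prod // scaler0 scalerA => /eqP.
rewrite scaler_eq0 (negPf (f_neq0 _)) ?orbF; last lia.
by move=> /eqP <-; rewrite mulrC; congr (_ * _); rewrite -(natr1 1); ring.
Qed.

(** The triple (w, e_1, f_(m-2)) gives 0 = (alpha + m - 2) w f_(m-1). *)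
Lemma eps2_rel eps : w ** f m.-1 = eps *: f m -> (alpha + m%:R - 2%:R) * eps = 0.
Proof.
move=> wf.
have := zinbiel_even (isT : ~~ (false && true)) w_even (e_even 1) (f_odd (m - 2)).
rewrite we1 smul0l fS ?fe1_prod; try lia.
rewrite -[X in X + _]scale1r -scalerDl smulZr (_ : (m - 2).+1 = m.-1); last lia.
rewrite wf scalerA => /esym/eqP; rewrite scaler_eq0 (negPf (f_neq0 _)) ?orbF; last lia.
move=> /eqP <-; congr (_ * _); rewrite natrB; last lia.
by ring.
Qed.

(** Determined by the product only for i + j < n, where [e (i + j)] is nonzero; the relations below
    stay in that range. *)
Definition ff_coef i j : K := coord [tuple e (i + j)%N] ord0 (f i ** f j).

Lemma ff_coefP i j : (0 < i)%N -> (0 < j)%N -> f i ** f j = ff_coef i j *: e (i + j)%N.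
Proof.
move=> i0 j0; have := ff_line i0 j0; rewrite -span_seq1 => /coord_span.
by rewrite big_ord1.
Qed.

(** The triple (e_1, f_i, f_j), with its odd sign, compared on e_(i+j+1). *)
Lemma ff_rel1 i j : (0 < i)%N -> (0 < j)%N -> (i + j < n.-1)%N ->
  ff_coef i.+1 j = ff_coef i j - ff_coef j i.
Proof.
move=> i0 j0 ltn; have := zinbiel_odd (e_even 1) (f_odd i) (f_odd j).
rewrite fS // !ff_coefP // (addnC j i) -scalerBl smulZr eS; last lia.
rewrite addSn => /eqP; rewrite -subr_eq0 -scalerBl scaler_eq0 subr_eq0.
by rewrite (negPf (e_neq0 _)) ?orbF => [/eqP|]; last lia.
Qed.

(** The triple (f_i, f_j, e_1); the factor i + j comes from e_(i+j) e_1. *)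
Lemma ff_rel2 i j : (0 < i)%N -> (0 < j)%N -> (i + j < n.-1)%N ->
  (i + j)%:R * ff_coef i j = (alpha + j%:R) * ff_coef i j.+1.
Proof.
move=> i0 j0 ltn.
have := zinbiel_even (isT : ~~ (true && false)) (f_odd i) (f_odd j) (e_even 1).
rewrite fe1_prod // fS // -[X in _ + X]scale1r -scalerDl smulZr !ff_coefP //.
rewrite smulZl ee_prod //; last lia.
rewrite addn1 /= bin1 addnS !scalerA => /eqP; rewrite -subr_eq0 -scalerBl scaler_eq0 subr_eq0.
rewrite (negPf (e_neq0 _)) ?orbF => [/eqP|]; last lia.
by rewrite subrK mulrC.
Qed.

(** The triple (f_i, e_1, f_j), with f_i e_1 = (alpha + i - 1) f_(i+1). *)
Lemma ff_rel3 i j : (0 < i)%N -> (0 < j)%N -> (i + j < n.-1)%N ->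
  (alpha + i%:R - 1) * ff_coef i.+1 j = (alpha + j%:R) * ff_coef i j.+1.
Proof.
move=> i0 j0 ltn.
have := zinbiel_even (isT : ~~ (false && true)) (f_odd i) (e_even 1) (f_odd j).
rewrite !fe1_prod // fS // -[X in _ ** (X + _)]scale1r -scalerDl smulZl smulZr !ff_coefP //.
rewrite addnS addSn !scalerA => /eqP; rewrite -subr_eq0 -scalerBl scaler_eq0 subr_eq0.
rewrite (negPf (e_neq0 _)) ?orbF => [/eqP ->|]; last lia.
by congr (_ * _); ring.
Qed.

(* ff_rel1, ff_rel2 and ff_rel3, together with their instance with i and j swapped,
   give (alpha - 1) * (ff_coef i j - ff_coef j i) = 0; the exceptional case alpha = 1
   is settled by starting from ff_coef 1 1 = 0. *)
Lemma ff_coef_eq0 i j : (0 < i)%N -> (0 < j)%N -> (i + j < n.-1)%N -> ff_coef i j = 0.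
Proof.
move=> i0 j0 ltn; have s0 : (i + j)%:R != 0 :> K by rewrite pnatr_eq0; lia.
(* Eliminating the coefficients of degree p + q + 1 leaves a relation between those at (p, q) and
   (q, p) only. *)
have r p q : (0 < p)%N -> (0 < q)%N -> (p + q < n.-1)%N ->
    (p + q)%:R * ff_coef p q = (alpha + p%:R - 1) * (ff_coef p q - ff_coef q p).
  by move=> p0 q0 pq; rewrite ff_rel2 // -ff_rel3 // ff_rel1.
have [alpha1|alpha_neq1] := eqVneq alpha 1; last first.
  have rij := r i j i0 j0 ltn; have := r j i j0 i0; rewrite addnC => /(_ ltn) rji.
  have d0 : ff_coef i j - ff_coef j i = 0.
    have : (2%:R * (alpha - 1)) * (ff_coef i j - ff_coef j i) = 0.
      (* The relation at (j, i) is subtracted from the one at (i, j). *)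
      have -> : 2%:R * (alpha - 1) = (alpha + i%:R - 1) + (alpha + j%:R - 1) - (i + j)%:R.
        by rewrite natrD; ring.
      rewrite mulrBl mulrDl -rij -[X in _ + X - _]opprK -mulrN opprB -rji mulrBr.
      by rewrite subrr.
    by move/eqP; rewrite !mulf_eq0 pnatr_eq0 subr_eq0 (negPf alpha_neq1) /= => /eqP.
  by move/eqP: rij; rewrite d0 mulr0 mulf_eq0 (negPf s0) => /eqP.
(* For alpha = 1, [ff_rel2] at (1, k) has the same nonzero factor k + 1 on both sides, so vanishing
   propagates from k = 1. *)
have one_j k : (0 < k)%N -> (k < n.-1)%N -> ff_coef 1 k = 0.
  elim: k => // [[|k]] IHk _ lt_k.
    have := r 1%N 1%N isT isT; rewrite subrr mulr0 => /(_ ltac:(lia))/eqP.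
    by rewrite mulf_eq0 pnatr_eq0 => /eqP.
  have := ff_rel2 (ltn0Sn 0) (ltn0Sn k); rewrite IHk ?mulr0 //; last lia.
  move=> /(_ ltac:(lia))/esym/eqP; rewrite mulf_eq0 alpha1 (addrC 1) natr1 pnatr_eq0 /=.
  by move=> /eqP.
(* For alpha = 1, [ff_rel3] passes from row i to row i + 1, within the same degree. *)
elim: i j i0 j0 ltn {s0} => // [[|i]] IHi j _ j0 ltn; first by apply: one_j => //; lia.
have := ff_rel3 (ltn0Sn i) j0; rewrite (IHi j.+1) //; last lia.
rewrite mulr0 => /(_ ltac:(lia))/eqP; rewrite mulf_eq0 alpha1 addrAC subrr add0r pnatr_eq0 /=.
by move=> /eqP.
Qed.

(** Degrees below n - 1 vanish by [ff_coef_eq0], degrees from n on because [e] does. In degree n - 1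
    every product with i > 1 is reduced by [ff_rel1] to degree n - 2, so only (1, n - 2)
    survives. *)
Lemma ff_prod i j : (0 < i)%N -> (0 < j)%N -> f i ** f j =
  if (i == 1%N) && (j == n - 2)%N then ff_coef 1 (n - 2) *: e n.-1 else 0.
Proof.
move=> i0 j0; rewrite ff_coefP //; case: (leqP n (i + j)) => [le_n|lt_n].
  rewrite e_ge // scaler0; case: andP => // -[/eqP i1 /eqP jn]; lia.
case: (ltnP (i + j) n.-1) => [lt|ge].
  rewrite ff_coef_eq0 // scale0r; case: andP => // -[/eqP i1 /eqP jn]; lia.
case: (i =P 1%N) => [i1|ni1].
  have jn : (j = n - 2)%N by lia.
  by rewrite i1 jn eqxx (_ : (1 + (n - 2) = n.-1)%N) //; lia.
case: i i0 ni1 lt_n ge => [|[|i]] // _ _ lt_n ge.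
rewrite [RHS]/= ff_rel1 ?ff_coef_eq0 ?subrr ?scale0r //; lia.
Qed.

(** This is [ff_rel2] at (1, n - 3), whose left side lies in the vanishing degree n - 2. *)
Lemma ff_rel : (alpha + n%:R - 3%:R) * ff_coef 1 (n - 2) = 0.
Proof.
have := @ff_rel2 1 (n - 3) isT; rewrite ff_coef_eq0 ?mulr0 //; try lia.
rewrite (_ : (n - 3).+1 = n - 2)%N; last lia.
move=> /(_ ltac:(lia) ltac:(lia)); rewrite natrB; last lia.
by rewrite addrA => <-.
Qed.

Lemma graded_normal_products eps1 eps2 :
  w ** f 1 = eps1 *: f 2 -> w ** f m.-1 = eps2 *: f m ->
  exists gam : K, [/\ normal_products n m e f w alpha eps1 eps2 gam,
    (alpha + 1) * eps1 = 0, (alpha + m%:R - 2%:R) * eps2 = 0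
    & (alpha + n%:R - 3%:R) * gam = 0].
Proof.
move=> wf1 wfm; exists (ff_coef 1 (n - 2)); split.
- split; [exact: ee_prod | exact: ew0 | exact: we0 | exact: ww0 | exact: ef_prod | | | |].
  + by move=> i j i0 j0; apply: fe_prod.
  + move=> j j0; case: (j =P 1%N) => [->//|j1]; case: (j =P m.-1) => [->//|jm].
    by apply: wf0; [lia | apply/eqP].
  + move=> [|[|j]] // _; first by rewrite fw1 wf1 scaleNr.
    exact: fw0.
  + exact: ff_prod.
- exact: eps1_rel.
- exact: eps2_rel.
- exact: ff_rel.
Qed.

End GradedZinbiel.

(** * Classification from a grading with pieces spanned by chains *)

Section GradedClassification.
Variables (K : numClosedFieldType) (B : superalgebra K) (n m : nat).
Local Notation "x ** y" := (smul B x y) (at level 40, left associativity).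
Hypotheses (zB : zinbiel B) (n5 : (4 < n)%N) (m4 : (3 < m)%N).
Variable G : bool -> nat -> {vspace B}.
Hypothesis G_homog : forall a k, (G a k <= homog B a)%VS.
Hypothesis G_mul : forall a b i j (x y : B), (0 < i)%N -> (0 < j)%N ->
  x \in G a i -> y \in G b j -> x ** y \in G (a (+) b) (i + j).
Variables (x w : B) (u f : nat -> B).
Hypotheses (xG : x \in G false 1) (wG : w \in G false 1).
Hypothesis uG : forall k, u k \in G false k.
Hypothesis fG : forall k, f k \in G true k.
Hypothesis G_u : forall k, (1 < k)%N -> (G false k <= <[u k]>)%VS.
Hypothesis G_f : forall k, (0 < k)%N -> (G true k <= <[f k]>)%VS.
Hypothesis xu : forall k, (0 < k)%N -> x ** u k = u k.+1.
Hypothesis xf : forall k, (0 < k)%N -> x ** f k = f k.+1.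
Hypothesis xw : x ** w = 0.
Hypothesis uwf_basis : adapted_basis n m u f w.
Variables (beta gamma : K).
Hypothesis xE : x = beta *: u 1 + gamma *: w.

(* If beta = 0 then x x = 0, whence u_1 x = - x u_1, u_2 x = 0 and
   0 = (x x) u_2 = u_4. *)
Lemma beta_neq0 : beta != 0.
Proof.
apply/eqP => b0.
have ev k : u k \in homog B false by apply: subvP (G_homog _ _) _ (uG k).
have xev : x \in homog B false by apply: subvP (G_homog _ _) _ xG.
have xx : x ** x = 0 by rewrite {2}xE smulDr !smulZr xw b0 scale0r scaler0 addr0.
have zin y z := @zinbiel_even _ _ zB false false false y z.
have u_neq0 k : (0 < k < n)%N -> u k != 0 by apply: adapted_e_neq0 uwf_basis.
have /vlineP[c uxE] : u 1 ** x \in <[u 2]>%VS.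
  by apply: subvP (G_u _) _ (G_mul (a := false) (b := false) (i := 1) (j := 1) _ _ _ xG).
have : (x ** x) ** u 1 = 0 by rewrite xx smul0l.
rewrite zin // xu // uxE -{1}[u 2]scale1r -scalerDl smulZr xu // => /eqP.
rewrite scaler_eq0 (negPf (u_neq0 _ _)) ?orbF; last lia.
move=> c0; have u2x : u 2 ** x = 0.
  by rewrite -xu // zin // xu // uxE addrC -{1}[u 2]scale1r -scalerDl (eqP c0) scale0r smul0r.
have : (x ** x) ** u 2 = 0 by rewrite xx smul0l.
rewrite zin // u2x addr0 !xu //; apply/eqP/u_neq0; lia.
Qed.

Lemma graded_classification :
  [\/ superalgebra_iso B (nf1 K n m),
      (exists alpha : K, superalgebra_iso B (nf2 n m alpha)),
      superalgebra_iso B (nf3 K n m)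
    | (n - 2 <= m)%N /\
      (superalgebra_iso B (nf4 K n m) \/ superalgebra_iso B (nf5 K n m))].
Proof.
have b0 := beta_neq0.
(* As x w = 0, x x = beta u_2; hence x, beta u_2, beta u_3, ... is a chain under left multiplication
   by x that starts at x itself. *)
pose e k := if (k <= 1)%N then x else beta *: u k.
have eG k : (0 < k)%N -> e k \in G false k.
  by case: k => [|[|k]] // _; rewrite /e /= memvZ.
have G_e k : (1 < k)%N -> (G false k <= <[e k]>)%VS.
  case: k => [|[|k]] // _; apply: subv_trans (G_u _) _ => //; rewrite -memvE.
  by apply/vlineP; exists beta^-1; rewrite /e /= scalerA mulVf ?scale1r.
have eS k : (0 < k)%N -> e 1 ** e k = e k.+1.
  case: k => [|[|k]] // _; rewrite /e /=; last by rewrite smulZr xu.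
  by rewrite {2}xE smulDr !smulZr xw scaler0 addr0 xu.
have ev k : e k \in homog B false.
  by rewrite /e; case: ifP => _; [|apply/memvZ]; apply: subvP (G_homog _ _) _ _;
    [exact: xG | exact: uG].
have wev : w \in homog B false by apply: subvP (G_homog _ _) _ wG.
have fod k : f k \in homog B true by apply: subvP (G_homog _ _) _ (fG k).
have bB : adapted_basis n m e f w.
  have [bE bF u0 f0] := uwf_basis; split=> // [|k nk]; last first.
    by rewrite /e (_ : (k <= 1)%N = false) ?u0 ?scaler0 //; lia.
  rewrite basisEdim size_tuple (size_basis bE) leqnn andbT.
  rewrite -[X in (X <= _)%VS](span_basis bE); apply/span_subvP => y /mapP[i _ ->].
  have mem k : (0 < k <= n)%N ->
      even_basis n e w k \in <<[tuple even_basis n e w i.+1 | i < n]>>%VS.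
    case: k => // k /= lt_k; apply/memv_span/mapP; exists (Ordinal lt_k) => //.
    by rewrite mem_enum.
  have memw : w \in <<[tuple even_basis n e w i.+1 | i < n]>>%VS.
    by have := mem n; rewrite /even_basis eqxx; apply; lia.
  have := mem i.+1 (ltn_ord i); rewrite /even_basis; case: eqP => // _.
  rewrite /e; case: i => [[|i] lt_i] /= mem_i.
    (* The vector u_1 is recovered as beta^-1 (x - gamma w). *)
    rewrite -[u 1](scalerK b0) -[beta *: u 1](addrK (gamma *: w)) -xE.
    by rewrite memvZ ?memvB ?memvZ.
  by rewrite -[u _](scalerK b0) memvZ.
have M a b i j (y z : B) := @G_mul a b i j y z.
have /vlineP[alpha fe] : f 1 ** e 1 \in <[f 2]>%VS.
  by apply: subvP (G_f _) _ (M true false 1%N 1%N _ _ _ _ _ _).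
have wf_line k : (0 < k)%N -> w ** f k \in <[f k.+1]>%VS.
  by move=> k0; apply: subvP (G_f _) _ (M false true 1%N k _ _ _ _ _ _).
have /vlineP[eps1 wf1] := wf_line 1%N isT.
have /vlineP[eps2 wfm] : w ** f m.-1 \in <[f m]>%VS.
  by rewrite -{2}(prednK (ltnW (ltnW (ltnW m4)))); apply: wf_line; lia.
have we : w ** e 1 \in <[e 2]>%VS.
  by apply: subvP (G_e _ _) _ (M false false 1%N 1%N _ _ _ _ _ _) => //; exact: eG.
have ww : w ** w \in <[e 2]>%VS.
  by apply: subvP (G_e _ _) _ (M false false 1%N 1%N _ _ _ _ _ _).
have fw : f 1 ** w \in <[f 2]>%VS.
  by apply: subvP (G_f _) _ (M true false 1%N 1%N _ _ _ _ _ _).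
have ff i j : (0 < i)%N -> (0 < j)%N -> f i ** f j \in <[e (i + j)%N]>%VS.
  by move=> i0 j0; apply: subvP (G_e _ _) _ (M true true i j _ _ _ _ _ _) => //; lia.
have [gam [np r1 r2 r3]] :=
  graded_normal_products zB n5 m4 bB ev wev fod eS xf xw we ww wf_line fw ff fe wf1 wfm.
exact: normal_products_classify bB np r1 r2 r3.
Qed.

End GradedClassification.

(** * Jordan bases and flags *)

Section JordanChains.
Variables (K : fieldType) (V : vectType K) (f : {linear V -> V}) (U : {vspace V}).

(** [tagnat.Rank l i] is the global index of position i in block l. Read by columns, the entries say
    f X_i = lam X_i + X_(i-1) inside a block. *)
Lemma jordan_mxE (s : seq nat) (lam : 'I_(size s) -> K) (l l' : 'I_(size s))
    (i : 'I_(nth 0%N s l)) (i' : 'I_(nth 0%N s l')) :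
  jordan_mx lam (tagnat.Rank l' i') (tagnat.Rank l i) =
  if l' == l then if (i' == i :> nat) then lam l else (i'.+1 == i)%N%:R else 0.
Proof.
have -> : jordan_mx lam (tagnat.Rank l' i') (tagnat.Rank l i) =
    submxblock (jordan_mx lam) l' l i' i by rewrite [RHS]mxE.
rewrite /jordan_mx /mxdiag mxblockK; case: (l' =P l) => [ll'|_]; last by rewrite mxE.
case: l / ll' i => i; rewrite conform_mx_id mxE -val_eqE.
by case: ifP => // _; case: ifP.
Qed.

(** The basis is a flat sequence in which block l starts at [sumn (take l s)]; eigenvalues are
    extended by 0 beyond the last block. *)
Lemma jordan_sizes_chain s : jordan_sizes f U s ->
  exists (lam : nat -> K) (X : seq V), [/\ basis_of U X, size X = sumn s
    & forall l i, (l < size s)%N -> (i < nth 0%N s l)%N ->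
      f X`_(sumn (take l s) + i) = lam l *: X`_(sumn (take l s) + i)
        + (if i == 0%N then 0 else X`_(sumn (take l s) + i.-1)) ].
Proof.
case=> _ _ [lam [X [bX fX]]].
have sumE l : (\sum_(k < size s | (k < l)%N) nth 0%N s k = sumn (take l s))%N.
  rewrite sumnE (big_nth 0%N) size_take_min.
  rewrite -(big_mkord (fun k => k < l)%N (nth 0%N s)).
  rewrite (big_nat_widen _ _ _ _ _ (geq_minr l (size s))).
  rewrite [LHS]big_nat_cond [RHS]big_nat_cond.
  apply: eq_big => k; first by rewrite leq_min; case: (k < l)%N; case: (k < size s)%N.
  by move=> /andP[_ kl]; rewrite nth_take.
exists (fun l => if insub l is Some o then lam o else 0), X; split=> //.
  rewrite size_tuple -[in RHS](take_size s) -sumE; apply: eq_bigl => k; exact/esym/ltn_ord.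
move=> l i lt_l lt_i; rewrite insubT.
pose lo : 'I_(size s) := Sub l lt_l; pose Y (i : 'I_(nth 0%N s lo)) := tnth X (tagnat.Rank lo i).
have YE (j : 'I_(nth 0%N s lo)) : X`_(sumn (take l s) + j) = Y j.
  by rewrite /Y (tnth_nth 0) tagnat.RankEsum sumE.
rewrite -/lo; rewrite (YE (Ordinal lt_i)) /Y fX.
(* The sum over global indices becomes one over pairs (block, position). *)
rewrite (reindex _ (onW_bij _ (tagnat.rank_bij (p_ := fun l : 'I_(size s) => nth 0%N s l)))) /=.
under eq_bigr do rewrite tagnat.rankE.
transitivity (\sum_(l' < size s) \sum_(i' < nth 0%N s l')
    jordan_mx lam (tagnat.Rank l' i') (tagnat.Rank lo (Ordinal lt_i))
      *: tnth X (tagnat.Rank l' i')).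
  by rewrite sig_big_dep.
rewrite (bigD1 lo) //= [X in _ + X]big1 ?addr0; last first.
  by move=> l' /negPf nl; rewrite big1 // => i' _; rewrite jordan_mxE nl scale0r.
under eq_bigr do rewrite jordan_mxE eqxx -/(Y _).
rewrite (bigD1 (Ordinal lt_i)) //= eqxx; congr (_ + _).
case: i lt_i => [|i] lt_i /=.
  by rewrite big1 // => i' ni; rewrite (negPf (ni : (i' != 0 :> nat))) scale0r.
rewrite (YE (Ordinal (ltnW lt_i))) (bigD1 (Ordinal (ltnW lt_i))); last first.
  by rewrite eqE /= ltn_eqF.
rewrite ltn_eqF // eqxx scale1r big1; first exact: addr0.
move=> i' /andP[].
by rewrite -!val_eqE /= => /negPf-> /negPf ni; rewrite eqSS ni scale0r.
Qed.

Hypothesis f_nil : exists k, forall u, u \in U -> iter k f u = 0.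

Lemma nilpotent_eigenvalue lam u : u \in U -> u != 0 -> f u = lam *: u -> lam = 0.
Proof.
move=> uU u0 fu; have [k /(_ u uU)] := f_nil.
have -> : iter k f u = lam ^+ k *: u.
  by elim: k => [|k IHk]; rewrite ?scale1r // iterS IHk linearZ /= fu scalerA exprSr.
by move/eqP; rewrite scaler_eq0 (negPf u0) orbF expf_eq0 => /andP[_ /eqP].
Qed.

(** The first vector of each block is an eigenvector, so nilpotency makes every eigenvalue 0. *)
Lemma jordan_sizes_nilpotent_chain s : jordan_sizes f U s ->
  exists X : seq V, [/\ basis_of U X, size X = sumn s
    & forall l i, (l < size s)%N -> (i < nth 0%N s l)%N ->
      f X`_(sumn (take l s) + i) =
      if i == 0%N then 0 else X`_(sumn (take l s) + i.-1) ].
Proof.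
move=> js; have [lam [X [bX sX fX]]] := jordan_sizes_chain js.
exists X; split=> // l i lt_l lt_i; rewrite fX //.
suff -> : lam l = 0 by rewrite scale0r add0r.
have s0 : (0 < nth 0%N s l)%N by apply: leq_ltn_trans lt_i.
have lt_X : (sumn (take l s) + 0 < size X)%N.
  rewrite sX -{2}(cat_take_drop l s) sumn_cat ltn_add2l.
  by rewrite (drop_nth 0%N) //= ltn_addr.
have X0 := mem_nth 0 lt_X.
apply: nilpotent_eigenvalue (basis_mem bX X0) (basis_not0 bX X0) _.
by rewrite fX //= addr0.
Qed.

(** A nilpotent Jordan block lowers positions by 1, so reading it backwards gives the iterates of f
    on its last vector. *)
Lemma rev_chain (X : seq V) d : (d <= size X)%N -> (0 < d)%N ->
  (forall i, (i < d)%N -> f X`_i = if i == 0%N then 0 else X`_i.-1) ->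
  rev (take d X) = mkseq (fun k => iter k f X`_d.-1) d /\ iter d f X`_d.-1 = 0.
Proof.
move=> ledX d0 fX.
have it k : (k < d)%N -> iter k f X`_d.-1 = X`_(d.-1 - k).
  elim: k => [|k IHk] ltk; first by rewrite subn0.
  rewrite iterS IHk ?(ltnW ltk) // fX; last lia.
  by rewrite (_ : (d.-1 - k == 0) = false)%N; [congr (X`_ _)|]; lia.
split; last by rewrite -(prednK d0) iterS it ?subnn ?fX //; lia.
have sz : size (rev (take d X)) = d by rewrite size_rev size_takel.
apply: (@eq_from_nth _ 0); rewrite sz ?size_mkseq // => i lti.
rewrite nth_rev size_takel // nth_take; last lia.
by rewrite nth_mkseq // it //; congr (X`_ _); lia.
Qed.

Lemma jordan_single d : jordan_sizes f U [:: d] ->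
  exists v, basis_of U (mkseq (fun k => iter k f v) d) /\ iter d f v = 0.
Proof.
move=> js; have [X [bX]] := jordan_sizes_nilpotent_chain js; rewrite /= addn0 => sX fX.
have d0 : (0 < d)%N by case: js => _; rewrite inE lt0n eq_sym.
have [eX v0] : rev (take d X) = mkseq (fun k => iter k f X`_d.-1) d /\ iter d f X`_d.-1 = 0.
  by apply: rev_chain; rewrite ?sX // => i lti; rewrite (fX 0%N i).
exists X`_d.-1; split=> //; rewrite -eX take_oversize ?sX //.
have /andP[/eqP <- frX] := bX.
rewrite /basis_of (perm_free (Y := X)) ?perm_rev // frX andbT.
by apply/eqP/eq_span => x; rewrite mem_rev.
Qed.

Lemma jordan_hook d : jordan_sizes f U [:: d; 1%N] ->
  exists v z, [/\ basis_of U (z :: mkseq (fun k => iter k f v) d), iter d f v = 0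
    & f z = 0].
Proof.
move=> js; have [X [bX]] := jordan_sizes_nilpotent_chain js; rewrite /= => sX fX.
have d0 : (0 < d)%N by case: js => _; rewrite !inE lt0n eq_sym; case: eqP.
have [eX v0] : rev (take d X) = mkseq (fun k => iter k f X`_d.-1) d /\ iter d f X`_d.-1 = 0.
  by apply: rev_chain; rewrite ?sX ?leq_addr // => i lti; rewrite (fX 0%N i).
exists X`_d.-1, X`_d; split=> //; last by have := fX 1%N 0%N; rewrite /= !addn0; apply.
have XE : rcons (take d X) X`_d = X.
  by rewrite -take_nth ?sX ?addn1 // take_oversize // sX addn1.
have rE : X`_d :: mkseq (fun k => iter k f X`_d.-1) d = rev X by rewrite -eX -rev_rcons XE.
rewrite rE; have /andP[/eqP <- frX] := bX.
rewrite /basis_of (perm_free (Y := X)) ?perm_rev // frX andbT.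
by apply/eqP/eq_span => x; rewrite mem_rev.
Qed.

End JordanChains.

(** * Filtrations spanned by a chain of vectors *)

Section Flags.
Variables (K : fieldType) (V : vectType K).

(** The terms W_k drop strictly until they reach 0, so dim W_k <= d - k. As W_k contains the d - k
    independent vectors c_k, ..., c_(d-1), these span it. *)
Lemma flag_chain (W : nat -> {vspace V}) (c : nat -> V) d :
  (forall k, (W k.+1 <= W k)%VS) -> (forall k, W k.+1 = W k -> W k = 0%VS) ->
  (\dim (W 0%N) <= d)%N -> (forall k, c k \in W k) -> free (mkseq c d) ->
  forall k, (W k <= <[c k]> + W k.+1)%VS.
Proof.
move=> dec str dimW cW fr k.
have le_dim j : (\dim (W j) <= d - j)%N.
  elim: j => [|j IHj]; first by rewrite subn0.
  have [e|ne] := eqVneq (W j.+1) (W j); first by rewrite e str // dimv0.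
  have : (\dim (W j.+1) < \dim (W j))%N.
    by rewrite ltnNge; apply: contra ne => le; rewrite eqEdim dec.
  lia.
case: (leqP d k) => [ledk|ltkd].
  have /eqP : \dim (W k) = 0%N by have := le_dim k; lia.
  by rewrite dimv_eq0 => /eqP->; apply: sub0v.
have mono i j : (i <= j)%N -> (W j <= W i)%VS.
  by move=> /subnK <-; elim: (j - i)%N => // l; apply: subv_trans; apply: dec.
have subW j : (<<drop j (mkseq c d)>> <= W j)%VS.
  apply/span_subvP => x /(nthP 0) [l]; rewrite size_drop size_mkseq => ltl <-.
  by rewrite nth_drop nth_mkseq; [apply: subvP (cW _); apply: mono; lia | lia].
have -> : W k = <<drop k (mkseq c d)>>%VS.
  apply/esym/eqP; rewrite eqEdim subW /=; have /eqP -> : free (drop k (mkseq c d)).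
    by move: fr; rewrite -{1}(cat_take_drop k (mkseq c d)) => /catr_free.
  by rewrite size_drop size_mkseq.
rewrite (drop_nth 0) ?size_mkseq // span_cons nth_mkseq //.
exact: addvS (subvv _) (subW _).
Qed.

End Flags.

(** * The associated graded superalgebra *)

(** The isomorphism maps each term of the filtration of A into that of B, and it is injective. *)
Lemma zpow_iso_eq0 (K : fieldType) (A B : superalgebra K) a k :
  superalgebra_iso A B -> zpow B a k.+1 = 0%VS -> zpow A a k.+1 = 0%VS.
Proof.
case=> phi [kphi _ hphi mphi] B0.
have sub : (zpow A a k.+1 <= phi @^-1: zpow B a k.+1)%VS.
  elim: k {B0} => [|k IHk].
    by apply/subvP => x xa; rewrite -memv_preim /zpow /= -hphi memv_img.
  rewrite zpowS //; apply/sprodP => x y x0 yk; rewrite -memv_preim mphi zpowS //.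
  apply: (sprodP _ _ _ (subvv _)); first by rewrite -hphi memv_img.
  by rewrite memv_preim (subvP IHk).
apply/eqP; rewrite -subv0; apply/subvP => x /(subvP sub).
by rewrite -memv_preim B0 -kphi memv_ker -memv0.
Qed.

Section GradedPieces.
Variables (K : fieldType) (Z : superalgebra K).
Local Notation N := (\dim {: Z}).
Local Notation B := (gr Z).

Definition gr_part a (g : B) : {ffun 'I_N -> Z} := if a then vsval g.2 else vsval g.1.

Definition gr_part_at a i (g : B) : Z := gr_part a g i.

Lemma gr_part_at_linear a i : linear (gr_part_at a i).
Proof. by move=> c g h; rewrite /gr_part_at /gr_part; case: a; rewrite /= !ffunE. Qed.
HB.instance Definition _ a i :=
  GRing.isLinear.Build K B Z *:%R (gr_part_at a i) (gr_part_at_linear a i).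

Lemma gr_partP (g h : B) : (forall a i, gr_part_at a i g = gr_part_at a i h) -> g = h.
Proof.
case: g h => [g0 g1] [h0 h1] gh; congr (_, _); apply/val_inj/ffunP => i.
  exact: (gh false i).
exact: (gh true i).
Qed.

(** Degrees are selected by a predicate so that single degrees and tails of the grading are treated
    alike. *)
Definition gr_deg (S : pred nat) : {vspace B} :=
  (\bigcap_(i < N | i.+1 \notin S)
     (lker (linfun (gr_part_at false i)) :&: lker (linfun (gr_part_at true i))))%VS.

Lemma mem_gr_deg (S : pred nat) (g : B) :
  reflect (forall a (i : 'I_N), i.+1 \notin S -> gr_part_at a i g = 0) (g \in gr_deg S).
Proof.
apply: (iffP idP) => [gS a i iS | gS].
  have : g \in (lker (linfun (gr_part_at false i))
                  :&: lker (linfun (gr_part_at true i)))%VS.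
    by apply: subvP gS; rewrite /gr_deg (bigD1 i) //= capvSl.
  rewrite memv_cap !memv_ker !lfunE /= => /andP[/eqP g0 /eqP g1].
  by case: a.
rewrite /gr_deg; elim/big_ind: _ => [|U W gU gW|i iS].
- exact: memvf.
- by rewrite memv_cap gU.
- by rewrite memv_cap !memv_ker !lfunE /= !gS ?eqxx.
Qed.

Lemma gr_part_mul c k (g h : B) : gr_part_at c k (smul B g h) =
  gr_pi Z c k.+1 (\sum_(i < N) \sum_(j < N | (i.+1 + j.+1 == k.+1)%N)
     (smul Z (gr_part_at false i g) (gr_part_at c j h)
      + smul Z (gr_part_at true i g) (gr_part_at (~~ c) j h))).
Proof.
rewrite /gr_part_at /gr_part; case: c => /=; rewrite !ffunE -linearD; apply: (congr1 (gr_pi _ _ _));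
by rewrite -big_split; apply: eq_bigr => i _; rewrite -big_split.
Qed.

Lemma gr_deg_mul (S T U : pred nat) (g h : B) :
  (forall i j, i \in S -> j \in T -> (i + j)%N \in U) ->
  g \in gr_deg S -> h \in gr_deg T -> smul B g h \in gr_deg U.
Proof.
move=> STU /mem_gr_deg gS /mem_gr_deg hT; apply/mem_gr_deg => c k kU.
rewrite gr_part_mul big1 ?linear0 // => i _; rewrite big1 // => j /eqP ijk.
have [iS|iS] := boolP (i.+1 \in S); last by rewrite !(gS _ _ iS) !smul0l addr0.
have [jT|jT] := boolP (j.+1 \in T); last by rewrite !(hT _ _ jT) !smul0r addr0.
by move: kU; rewrite -ijk STU.
Qed.

Lemma gr_deg_empty (S : pred nat) : (forall k, (0 < k <= N)%N -> k \notin S) -> gr_deg S = 0%VS.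
Proof.
move=> S0; apply/eqP; rewrite -subv0; apply/subvP => g /mem_gr_deg gS.
rewrite memv0; apply/eqP/gr_partP => a i; rewrite gS ?linear0 //.
by apply: S0; rewrite ltn_ord.
Qed.

(** All degrees of gr(Z) are at least 1, so each left multiplication raises the degree. *)
Lemma zpow_gr a k : (zpow B a k.+1 <= gr_deg (fun i => k < i)%N)%VS.
Proof.
elim: k => [|k IHk]; first by apply/subvP => g _; apply/mem_gr_deg => c i; rewrite unfold_in.
rewrite zpowS //; apply/sprodP => g h _ hk.
apply: (@gr_deg_mul (fun i => 0 < i)%N (fun i => k < i)%N).
- by move=> i j; rewrite !unfold_in /=; lia.
- by apply/mem_gr_deg => c i; rewrite unfold_in.
- by apply: subvP hk.
Qed.

(** In gr(Z) no degree exceeds N, so its filtration has reached 0 at index N + 1. *)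
Lemma zpow_naturally_graded a : superalgebra_iso Z B -> zpow Z a N.+1 = 0%VS.
Proof.
move=> iso; apply: (zpow_iso_eq0 iso); apply/eqP; rewrite -subv0.
rewrite -(@gr_deg_empty (fun i => N < i)%N) ?zpow_gr // => k /andP[_].
by rewrite unfold_in -leqNgt.
Qed.

Definition gr_piece a k : {vspace B} := (gr_deg (pred1 k) :&: homog B a)%VS.

Lemma gr_piece_homog a k : (gr_piece a k <= homog B a)%VS.
Proof. exact: capvSr. Qed.

Lemma gr_piece_mul a b i j (g h : B) : g \in gr_piece a i -> h \in gr_piece b j ->
  smul B g h \in gr_piece (a (+) b) (i + j).
Proof.
rewrite !memv_cap => /andP[gi ga] /andP[hj hb]; rewrite smul_homog // andbT.
by apply: gr_deg_mul gi hj => p q; rewrite !inE => /eqP-> /eqP->.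
Qed.

Definition gr_symf a k (x : Z) : {ffun 'I_N -> Z} :=
  [ffun l : 'I_N => if l.+1 == k then gr_pi Z a k x else 0].

Lemma gr_symf_mem a k x : gr_symf a k x \in gr_space Z a.
Proof.
by apply/mem_gr_space => l; rewrite ffunE; case: eqP => [<-|_]; rewrite ?memv_pi ?mem0v.
Qed.

(* The class of x \in Z_a^k in the summand of degree k of gr(Z); it is 0 unless
   1 <= k <= \dim {:Z}. *)
Definition gr_sym a k (x : Z) : B :=
  (if a return subvs_of (gr_space Z a) -> B then fun v => (0, v) else fun v => (v, 0))
    (Subvs (gr_symf_mem a k x)).

Lemma gr_part_sym a b k l x : gr_part_at a l (gr_sym b k x) =
  if (a == b) && (l.+1 == k) then gr_pi Z b k x else 0.
Proof.
by rewrite /gr_part_at /gr_part /gr_sym; case: b; case: a; rewrite /= ?ffunE.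
Qed.

Lemma gr_sym_linear a k : linear (gr_sym a k).
Proof.
move=> c x y; apply: gr_partP => b i; rewrite linearP /= !gr_part_sym.
by case: ifP => _; [exact: linearP | rewrite /= scaler0 addr0].
Qed.
HB.instance Definition _ a k :=
  GRing.isLinear.Build K Z B *:%R (gr_sym a k) (gr_sym_linear a k).

Lemma gr_sym_eq0 a k x : (0 < k)%N -> x \in zpow Z a k.+1 -> gr_sym a k x = 0.
Proof.
move=> k0 xk; apply: gr_partP => b i; rewrite gr_part_sym linear0.
case: ifP => // _; apply/eqP; rewrite gr_pi_eq0 //.
exact: subvP (zpowS_sub _ _ k0) _ xk.
Qed.

Lemma gr_sym_piece a k x : gr_sym a k x \in gr_piece a k.
Proof.
rewrite memv_cap; apply/andP; split.
  by apply/mem_gr_deg => b i; rewrite inE gr_part_sym => /negPf->; rewrite andbF.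
by rewrite /= mem_pair_homog /gr_sym; case: a.
Qed.

Lemma gr_part_homog a i (g : B) : g \in homog B a -> gr_part_at (~~ a) i g = 0.
Proof.
by rewrite mem_pair_homog /gr_part_at /gr_part; case: a => /= /eqP->; rewrite ffunE.
Qed.

Lemma gr_part_comp a i (g : B) : gr_part_at a i g \in gr_comp Z a i.+1.
Proof. by rewrite /gr_part_at /gr_part; case: a; apply/mem_gr_space/subvsP. Qed.

Lemma gr_part_zpow a i (g : B) : gr_part_at a i g \in zpow Z a i.+1.
Proof. by apply: subvP (gr_part_comp a i g); apply: diffvSl. Qed.

Lemma gr_homog_sum a g : g \in homog B a ->
  g = \sum_(i < N) gr_sym a i.+1 (gr_part_at a i g).
Proof.
move=> ga; apply: gr_partP => b i; rewrite linear_sum /= (bigD1 i) //= big1 ?addr0.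
  rewrite gr_part_sym eqxx andbT; case: eqP => [->|/eqP nb].
    by rewrite gr_pi_id ?gr_part_comp.
  have -> : b = ~~ a by case: a b nb {ga} => [] [].
  by rewrite gr_part_homog.
by move=> j ji; rewrite gr_part_sym eqSS val_eqE (eq_sym i) (negPf ji) andbF.
Qed.

Lemma gr_piece_sym a k g : (0 < k)%N -> g \in gr_piece a k ->
  exists2 x, x \in zpow Z a k & g = gr_sym a k x.
Proof.
case: k => // k _; rewrite memv_cap => /andP[/mem_gr_deg gk ga].
have [ltkN|leNk] := ltnP k N; last first.
  exists 0; rewrite ?mem0v // linear0; apply/eqP; rewrite -memv0.
  rewrite -(@gr_deg_empty (pred1 k.+1)); first by apply/mem_gr_deg.
  by move=> j jN; rewrite inE; lia.
exists (gr_part_at a (Ordinal ltkN) g); first exact: gr_part_zpow.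
rewrite {1}(gr_homog_sum ga) (bigD1 (Ordinal ltkN)) //= big1 ?addr0 // => i ik.
by rewrite gk ?linear0 // inE eqSS.
Qed.

Lemma gr_homog_sub a (U : {vspace B}) :
  (forall k x, (0 < k)%N -> x \in zpow Z a k -> gr_sym a k x \in U) -> (homog B a <= U)%VS.
Proof.
move=> symU; apply/subvP => g /gr_homog_sum ->; apply: memv_suml => i _.
by apply: symU => //; apply: gr_part_zpow.
Qed.

Lemma gr_sym_mul b i j x y : graded_product Z -> (0 < i)%N -> (0 < j)%N ->
  x \in zpow Z false i -> y \in zpow Z b j ->
  smul B (gr_sym false i x) (gr_sym b j y) = gr_sym b (i + j) (smul Z x y).
Proof.
move=> grP i0 j0 xi yj.
(* Beyond degree N both sides lie in a zero piece; up to N, [gr_mul_class] applies. *)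
have [ltN|leN] := ltnP (i + j).-1 N; last first.
  have H : gr_deg (pred1 (i + j)%N) = 0%VS.
    by apply: gr_deg_empty => k; rewrite inE; lia.
  have z (g : B) : g \in gr_piece b (i + j) -> g = 0.
    by rewrite memv_cap H memv0 => /andP[/eqP].
  rewrite [LHS]z ?[RHS]z ?gr_sym_piece //.
  exact: (gr_piece_mul (gr_sym_piece false i x) (gr_sym_piece b j y)).
have symE a k l v : k.+1 = l -> forall lt_k : (k < N)%N, gr_sym a l v =
    (if a return subvs_of (gr_space Z a) -> B then fun v => (0, v) else fun v => (v, 0))
      (gr_class a (Ordinal lt_k) v).
  move=> <- lt_k; apply: gr_partP => c q; rewrite gr_part_sym /gr_part_at /gr_part.
  by case: a; case: c; rewrite /= ?ffunE // -val_eqE /= ?eqSS; case: eqP => // ->.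
have lti : (i.-1 < N)%N by lia.
have ltj : (j.-1 < N)%N by lia.
rewrite (symE _ _ _ _ (prednK i0) lti) (symE _ _ _ _ (prednK j0) ltj).
rewrite (symE _ (i + j).-1 _ _ _ ltN); last by lia.
have := @gr_mul_class _ Z false b (Ordinal lti) (Ordinal ltj) (Ordinal ltN) x y grP.
rewrite /= !prednK //; last lia.
move=> /(_ erefl xi yj); case: b {yj symE} => <-.
  by congr (_, _); rewrite /= ?linear0l ?linear0r ?addr0.
by congr (_, _); rewrite /= ?linear0l ?linear0r ?addr0.
Qed.

End GradedPieces.

Arguments gr_sym : simpl never.

(** * Filiform superalgebras *)

Section Filtration.
Variables (K : fieldType) (Z : superalgebra K).
Implicit Types (a : bool) (k : nat).
Hypothesis grP : graded_product Z.
Hypothesis nilZ : forall a, zpow Z a (\dim {:Z}).+1 = 0%VS.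

Lemma zpow_mul a x y k : (0 < k)%N ->
  x \in homog Z false -> y \in zpow Z a k -> smul Z x y \in zpow Z a k.+1.
Proof. by move=> k0 x0 yk; rewrite zpowS //; apply: (sprodP _ _ _ (subvv _)). Qed.

Lemma zpow_iter a x y j k : (0 < k)%N ->
  x \in homog Z false -> y \in zpow Z a k -> iter j (smul Z x) y \in zpow Z a (j + k).
Proof.
move=> k0 x0 yk; elim: j => // j IHj.
by apply: zpow_mul; rewrite ?addn_gt0 ?k0 ?orbT.
Qed.

Lemma zpow_le a i j : (0 < i)%N -> (i <= j)%N -> (zpow Z a j <= zpow Z a i)%VS.
Proof.
move=> i0 /subnK <-; elim: (j - i)%N => // l IHl.
by apply: subv_trans IHl; apply: zpowS_sub; rewrite addn_gt0 i0 orbT.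
Qed.

(** Once two consecutive terms agree the filtration is constant, yet it ends at 0. *)
Lemma zpow_stop a k : zpow Z a k.+2 = zpow Z a k.+1 -> zpow Z a k.+1 = 0%VS.
Proof.
move=> stop; have stay l : zpow Z a (l + k).+1 = zpow Z a k.+1.
  elim: l => // l IHl; rewrite addSn -stop zpowS //; congr sprod.
  by rewrite IHl.
apply/eqP; rewrite -subv0 -(stay (\dim {:Z})) -(nilZ a) zpow_le //; lia.
Qed.

Lemma smul_nilpotent a x : x \in homog Z false ->
  exists k, forall y, y \in homog Z a -> iter k (smul Z x) y = 0.
Proof.
move=> x0; exists (\dim {:Z}) => y ya; apply/eqP; rewrite -memv0 -(nilZ a) -addn1.
exact: zpow_iter.
Qed.

(* Z_0^k lies in x Z_0 + Z_0^(k+1) for k >= 2; iterate up to Z_0^k = 0. *)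
Lemma zpow2_sub_img x : (homog Z false <= <[x]> + zpow Z false 2)%VS ->
  (zpow Z false 2 <= linfun (smul Z x) @: homog Z false)%VS.
Proof.
move=> xZ2; set U := (_ @: _)%VS.
have step k : (zpow Z false k.+2 <= U + zpow Z false k.+3)%VS.
  rewrite zpowS //; apply/sprodP => y z y0 zk.
  have /memv_addP[_ /vlineP[c ->] [y' y'2 ->]] := subvP xZ2 _ y0.
  rewrite smulDl smulZl memv_add //.
    rewrite memvZ // -(lfunE (smul Z x)) memv_img //.
    exact: subvP (@zpow_le false 1 k.+1 _ _) _ zk.
  (* The component of y in Z_0^2 gains an extra degree by [graded_product]. *)
  exact: (sprodP _ _ _ (@grP false false 2 k.+1 _ _)).
have sub k : (zpow Z false 2 <= U + zpow Z false k.+2)%VS.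
  elim: k => [|k IHk]; first exact: addvSr.
  apply: subv_trans IHk _; rewrite subv_add; apply/andP; split; [exact: addvSl | exact: step].
apply: subv_trans (sub (\dim {:Z})) _.
rewrite (_ : zpow Z false _.+2 = 0%VS) ?addv0 //.
by apply/eqP; rewrite -subv0 -(nilZ false) zpow_le.
Qed.

(** Here dim Z_0 = d + 2. If dim Z_0^2 > d, then x and Z_0^2 span Z_0, so Z_0^2 lies in x Z_0; but x
    Z_0 is spanned by the d vectors L_x^k v with 1 <= k <= d. *)
Lemma zpow2_dim x v z d : x \notin zpow Z false 2 -> x \in homog Z false ->
  basis_of (homog Z false) (z :: mkseq (fun k => iter k (smul Z x) v) d.+1) ->
  iter d.+1 (smul Z x) v = 0 -> smul Z x z = 0 -> (\dim (zpow Z false 2) <= d)%N.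
Proof.
move=> x2 x0 bZ v0 z0; rewrite leqNgt; apply/negP => ltd.
have dimZ : \dim (homog Z false) = d.+2.
  by have /eqP := basis_free bZ; rewrite (span_basis bZ) /= size_map size_iota.
have xZ2 : (homog Z false <= <[x]> + zpow Z false 2)%VS.
  have sub : (<[x]> + zpow Z false 2 <= homog Z false)%VS.
    by rewrite subv_add; apply/andP; split; [rewrite -memvE | exact: (@zpow_le false 1 2)].
  suff /eqP -> : (<[x]> + zpow Z false 2 == homog Z false)%VS by [].
  rewrite eqEdim sub dimZ dimv_disjoint_sum.
    rewrite dim_vline (_ : x != 0) //=; apply: contraNneq x2 => ->; exact: mem0v.
  apply/eqP; rewrite -subv0; apply/subvP => y; rewrite memv_cap memv0.
  case/andP=> /vlineP[c ->] cx; apply: contraNT x2; rewrite scaler_eq0 negb_or => /andP[c0 _].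
  by rewrite -[x](scalerK c0) memvZ.
have := leq_trans ltd (dimvS (zpow2_sub_img xZ2)); rewrite ltnNge => /negP; apply.
have sub : (linfun (smul Z x) @: homog Z false <=
    <<mkseq (fun k => iter k.+1 (smul Z x) v) d>>)%VS.
  rewrite -(span_basis bZ) limg_span; apply/span_subvP => y /mapP[w + ->].
  rewrite lfunE /= inE => /predU1P[->|]; first by rewrite z0 mem0v.
  case/mapP=> k; rewrite mem_iota => /= ltk ->; rewrite -iterS.
  have [->|nkd] := eqVneq k d; first by rewrite v0 mem0v.
  by apply/memv_span/mapP; exists k => //; rewrite mem_iota; lia.
by apply: leq_trans (dimvS sub) _; apply: leq_trans (dim_span _) _; rewrite size_mkseq.
Qed.

End Filtration.

(** * Passage from a filiform superalgebra to its graded pieces *)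

Section Filiform.
Variables (K : numClosedFieldType) (Z : superalgebra K) (n m : nat).

Lemma superalgebra_iso_dim (A B : superalgebra K) a :
  superalgebra_iso A B -> \dim (homog A a) = \dim (homog B a).
Proof.
case=> phi [kphi _ hphi _]; rewrite -hphi limg_dim_eq // kphi; exact: capv0.
Qed.

Lemma span_basis_of (V : vectType K) d (U : {vspace V}) (X : nat -> V) :
  \dim U = d -> (U <= <<[tuple X i.+1 | i < d]>>)%VS -> basis_of U [tuple X i.+1 | i < d].
Proof. by move=> dU subU; rewrite basisEdim subU size_tuple dU /=. Qed.

Lemma filiform_classification :
  zinbiel Z -> naturally_graded Z -> filiform Z ->
  \dim (homog Z false) = n -> \dim (homog Z true) = m ->
  (4 < n)%N -> (3 < m)%N ->
  [\/ superalgebra_iso Z (nf1 K n m),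
      (exists alpha : K, superalgebra_iso Z (nf2 n m alpha)),
      superalgebra_iso Z (nf3 K n m)
    | (n - 2 <= m)%N /\
      (superalgebra_iso Z (nf4 K n m) \/ superalgebra_iso Z (nf5 K n m))].
Proof.
move=> zZ [grP iso] [x [x0 x2 + + _]] dimn dimm n5 m4; rewrite dimn dimm.
have nilZ a := zpow_naturally_graded a iso.
(* Nilpotency of L_x turns the Jordan forms into bases: z, v, L v, ..., L^(n-2) v with x z = 0 in
   Z_0, and f0, ..., L^(m-1) f0 in Z_1. *)
move=> /(jordan_hook (smul_nilpotent nilZ false x0)).
case=> v [z [bE vn xz]] /(jordan_single (smul_nilpotent nilZ true x0)) [f0 [bF fm]].
pose L := smul Z x; pose B := gr Z.
have n1 : n.-1 = n.-2.+1 by lia.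
have vE : v \in homog Z false.
  rewrite (basis_mem bE) // inE; apply/orP; right; apply/mapP.
  by exists 0%N; rewrite // mem_iota; lia.
have zE : z \in homog Z false by rewrite (basis_mem bE) // mem_head.
have fE : f0 \in homog Z true.
  by rewrite (basis_mem bF) //; apply/mapP; exists 0%N;
     rewrite // mem_iota; lia.
have vk k : iter k L v \in zpow Z false k.+1 by rewrite -addn1; apply: zpow_iter.
have fk k : iter k L f0 \in zpow Z true k.+1 by rewrite -addn1; apply: zpow_iter.
(* The flag starts at Z_0^2, of dimension at most n - 2, which contains L v, ..., L^(n-2) v; degree
   1 is treated apart, with both v and z. *)
have chain0 k : (zpow Z false k.+2 <= <[iter k.+1 L v]> + zpow Z false k.+3)%VS.
  apply: (flag_chain (W := fun k => zpow Z false k.+2)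
    (c := fun k => iter k.+1 L v) (d := n.-2)).
  - by move=> j; apply: zpowS_sub.
  - by move=> j; apply: zpow_stop.
  - by apply: (zpow2_dim grP nilZ x2 x0 (v := v) (z := z)); rewrite -?n1.
  - by move=> j; apply: vk.
  - have := basis_free bE; rewrite free_cons => /andP[_].
    rewrite n1 /mkseq /= free_cons => /andP[_]; rewrite (iotaDl 1 0) -map_comp.
    by congr free; apply: eq_map => j; rewrite /= -iterSr.
have chain1 k : (zpow Z true k.+1 <= <[iter k L f0]> + zpow Z true k.+2)%VS.
  apply: (flag_chain (W := fun k => zpow Z true k.+1) (c := fun k => iter k L f0) (d := m)).
  - by move=> j; apply: zpowS_sub.
  - by move=> j; apply: zpow_stop.
  - by rewrite dimm.
  - by move=> j; apply: fk.
  - exact: basis_free bF.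
have top : (homog Z false <= <[v]> + <[z]> + zpow Z false 2)%VS.
  rewrite -{1}(span_basis bE); apply/span_subvP => y; rewrite inE => /predU1P[->|].
    exact: subvP (subv_trans (addvSr _ _) (addvSl _ _)) _ (memv_line _).
  case/mapP=> -[|k] _ ->.
    exact: subvP (subv_trans (addvSl _ _) (addvSl _ _)) _ (memv_line _).
  apply: (subvP (addvSr _ _)); apply: (subvP _ _ (vk k.+1)); exact: zpow_le.
have {}top y : y \in homog Z false ->
    exists c d, gr_sym false 1 y = c *: gr_sym false 1 v + d *: gr_sym false 1 z.
  case/(subvP top)/memv_addP=> _ /memv_addP[_ /vlineP[c ->] [_ /vlineP[d ->] ->]] [t t2 ->].
  by exists c, d; rewrite !linearD !linearZ /= (gr_sym_eq0 _ t2) // addr0.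
pose u k := gr_sym false k (iter k.-1 L v).
pose w := gr_sym false 1 z.
pose f k := gr_sym true k (iter k.-1 L f0).
pose x' := gr_sym false 1 x.
have iL k l y : (l <= k)%N -> iter l L y = 0 -> iter k L y = 0.
  move=> /subnK <- y0; rewrite iterD y0; elim: (k - l)%N => //= j ->; exact: smul0r.
have B_iso : superalgebra_iso Z B := iso.
suff : [\/ superalgebra_iso B (nf1 K n m),
      (exists alpha : K, superalgebra_iso B (nf2 n m alpha)),
      superalgebra_iso B (nf3 K n m)
    | (n - 2 <= m)%N /\
      (superalgebra_iso B (nf4 K n m) \/ superalgebra_iso B (nf5 K n m))].
  have tr C := superalgebra_iso_trans (C := C) B_iso.
  case=> [/tr|[al /tr]|/tr|[nm [/tr|/tr]]]; [by constructor 1| |by constructor 3| |].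
  - by constructor 2; exists al.
  - by constructor 4; split=> //; left.
  - by constructor 4; split=> //; right.
have [beta [gamma xE]] := top x x0.
have line0 k y : (1 < k)%N -> y \in zpow Z false k -> exists c, gr_sym false k y = c *: u k.
  case: k => [|[|k]] // _ /(subvP (chain0 k))/memv_addP[_ /vlineP[c ->] [t tk ->]].
  by exists c; rewrite linearD linearZ /= (gr_sym_eq0 _ tk) // addr0.
have line1 k y : (0 < k)%N -> y \in zpow Z true k -> exists c, gr_sym true k y = c *: f k.
  case: k => [|k] // _ /(subvP (chain1 k))/memv_addP[_ /vlineP[c ->] [t tk ->]].
  by exists c; rewrite linearD linearZ /= (gr_sym_eq0 _ tk) // addr0.
have u_ge k : (n <= k)%N -> u k = 0 by move=> nk; rewrite /u (iL _ n.-1) ?linear0 //; lia.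
have f_gt k : (m < k)%N -> f k = 0 by move=> mk; rewrite /f (iL _ m) ?linear0 //; lia.
have bB : adapted_basis n m u f w.
  (* Spanning suffices, since gr(Z) has even dimension n and odd dimension m. *)
  split=> //; apply: span_basis_of; rewrite -?(superalgebra_iso_dim _ B_iso) //.
    apply: gr_homog_sub => k y k0 yk.
    have mem j : (0 < j <= n)%N ->
        even_basis n u w j \in <<[tuple even_basis n u w i.+1 | i < n]>>%VS.
      case: j => // j ltj; apply/memv_span/mapP; exists (Ordinal ltj) => //.
      by rewrite mem_enum.
    have memu j : (0 < j)%N -> u j \in <<[tuple even_basis n u w i.+1 | i < n]>>%VS.
      move=> j0; have [ltj|/u_ge->] := ltnP j n; last exact: mem0v.
      by have := mem j; rewrite /even_basis ltn_eqF //; apply; lia.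
    have memw : w \in <<[tuple even_basis n u w i.+1 | i < n]>>%VS.
      by have := mem n; rewrite /even_basis eqxx; apply; lia.
    case: k k0 yk => [|[|k]] // _ yk.
      by have [c [d ->]] := top y yk; rewrite memvD ?memvZ // memu.
    by have [c ->] := line0 k.+2 y isT yk; rewrite memvZ ?memu.
  apply: gr_homog_sub => k y k0 yk; have [c ->] := line1 k y k0 yk; apply: memvZ.
  have [/f_gt->|lek] := ltnP m k; first exact: mem0v.
  case: k k0 yk lek => // k _ _ ltk; apply/memv_span/mapP; exists (Ordinal ltk) => //.
  by rewrite mem_enum.
have x1 : x \in zpow Z false 1 by [].
apply: (@graded_classification K B n m (zinbiel_iso B_iso zZ) n5 m4 (@gr_piece _ Z)
   _ _ x' w u f _ _ _ _ _ _ _ _ _ bB beta gamma xE).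
- exact: gr_piece_homog.
- by move=> a b i j g h _ _; apply: gr_piece_mul.
- exact: gr_sym_piece.
- exact: gr_sym_piece.
- by move=> k; apply: gr_sym_piece.
- by move=> k; apply: gr_sym_piece.
- move=> k k1; apply/subvP => g /gr_piece_sym[|y yk ->]; first exact: ltnW.
  by have [c ->] := line0 k y k1 yk; rewrite memvZ ?memv_line.
- move=> k k0; apply/subvP => g /gr_piece_sym[//|y yk ->].
  by have [c ->] := line1 k y k0 yk; rewrite memvZ ?memv_line.
- by case=> // k _; rewrite /x' /u gr_sym_mul.
- by case=> // k _; rewrite /x' /f gr_sym_mul.
- by rewrite /x' /w gr_sym_mul // xz linear0.
Qed.

End Filiform.

Theorem theorem16 (R : realType) (Z : superalgebra R[i]) (n m : nat) :
  zinbiel Z -> naturally_graded Z -> filiform Z ->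
  \dim (homog Z false) = n -> \dim (homog Z true) = m ->
  (5 <= n)%N -> (3 < m)%N ->
  [\/ superalgebra_iso Z (nf1 R[i] n m),
      (exists alpha : R[i], superalgebra_iso Z (nf2 n m alpha)),
      superalgebra_iso Z (nf3 R[i] n m)
    | (n - 2 <= m)%N /\
      (superalgebra_iso Z (nf4 R[i] n m) \/ superalgebra_iso Z (nf5 R[i] n m))].
Proof. exact: filiform_classification. Qed.
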